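(* Let $R$ be a Hecke symmetry on a finite dimensional vector space $V$ satisfying the $1$-dimensional source condition. Then the $R$-symmetric algebra $\mathbb S(V,R)$ and the $R$-skewsymmetric algebra $\Lambda(V,R)$ are Koszul, and their Hilbert series satisfy $h_{\mathbb S(V,R)}(t)\,h_{\Lambda(V,R)}(-t)=1$.
   Context: $\Bbbk$ is a field. A Hecke symmetry with parameter $0\neq q\in\Bbbk$ on $V$ is a linear operator $R$ on $V\otimes V$ with $(R+\mathrm{id})(R-q\,\mathrm{id})=0$ and $R_1R_2R_1=R_2R_1R_2$ on $V^{\otimes3}$, where $R_1=R\otimes\mathrm{id}_V$, $R_2=\mathrm{id}_V\otimes R$. It gives a representation of the Hecke algebra $\mathcal H_n(q)$ (generators $T_1,\dots,T_{n-1}$, braid relations, $(T_i-q)(T_i+1)=0$) on $V^{\otimes n}$ with $T_i$ acting by $\mathrm{id}^{\otimes(i-1)}\otimes R\otimes\mathrm{id}^{\otimes(n-i-1)}$. An indecomposable $\mathcal H_n$-module has a $1$-dimensional source if it is a direct summand of a module induced from a $1$-dimensional representation of a parabolic subalgebra $\mathcal H_\lambda$ (generated by $T_j$, $j\notin\{\lambda_1,\lambda_1+\lambda_2,\dots\}$, $\lambda$ a composition of $n$). $R$ satisfies the $1$-dimensional source condition if for every $n>0$ all indecomposable direct summands of the $\mathcal H_n$-module $V^{\otimes n}$ have $1$-dimensional sources. $\mathbb S(V,R)$ and $\Lambda(V,R)$ are the quotients of the tensor algebra $\mathbb T(V)$ by the ideals generated by $\operatorname{Im}(R-q\,\mathrm{id})$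 and $\operatorname{Ker}(R-q\,\mathrm{id})$ respectively. A quadratic graded algebra $A$ is Koszul if its right Koszul complex is a resolution of the trivial module $\Bbbk$ (equivalently, $\Bbbk$ has a linear graded free resolution). The Hilbert series is $h_A(t)=\sum_n(\dim A_n)t^n$. *)

(* Defs.v *)
From HB Require Import structures.
From mathcomp Require Import all_boot all_order all_algebra.
Set Implicit Arguments. Unset Strict Implicit. Unset Printing Implicit Defensive.
Import GRing.Theory.
Local Open Scope ring_scope.

Section HeckeKoszul.
Variables (F : fieldType) (d : nat).

(* V = F^d with standard basis e_0..e_{d-1}.  V^{(x) n} has basis e_w indexed by
   words w : 'I_n -> 'I_d; an element of V^{(x) n} is its coordinate function. *)
Definition word (n : nat) := {ffun 'I_n -> 'I_d}.
Definition tens (n : nat) := {ffun word n -> F^o}.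

Definition splice n (w : word n) (i : nat) (u : word 2) : word n :=
  [ffun k : 'I_n => if val k == i then u ord0
                    else if val k == i.+1 then u ord_max else w k].

(* id^{(x) i} (x) R (x) id^{(x) (n-i-2)} on V^{(x) n}  (positions i, i+1, 0-based);
   paper's T_{i+1}.  (Zero when i+1 >= n; never used then.) *)
Definition Top n (R : 'End(tens 2)) (i : nat) : 'End(tens n) :=
  linfun (fun x : tens n => ([ffun w : word n =>
    (match (insub i : option 'I_n), (insub i.+1 : option 'I_n) with
    | Some j1, Some j2 =>
        R [ffun u : word 2 => x (splice w i u)]
          [ffun k : 'I_2 => if val k == 0%N then w j1 else w j2]
    | _, _ => 0
    end : F^o)] : tens n)).

Definition hecke_sym (q : F) (R : 'End(tens 2)) : Prop :=
  q != 0 /\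
  (forall x : tens 2, (R (R x - q *: x) + (R x - q *: x)) = 0) /\
  (forall x : tens 3, Top 3 R 0 (Top 3 R 1 (Top 3 R 0 x)) = Top 3 R 1 (Top 3 R 0 (Top 3 R 1 x))).

Definition hmod (n : nat) (q : F) (M : vectType F) (t : nat -> 'End(M)) : Prop :=
  (forall i, (i.+1 < n)%N -> forall x, t i (t i x + x) - q *: (t i x + x) = 0) /\
  (forall i, (i.+2 < n)%N -> forall x, t i (t i.+1 (t i x)) = t i.+1 (t i (t i.+1 x))) /\
  (forall i j, (i.+1 < n)%N -> (j.+1 < n)%N -> (i.+1 < j)%N -> forall x, t i (t j x) = t j (t i x)).

Definition submod n (M : vectType F) (t : nat -> 'End(M)) (U : {vspace M}) : Prop :=
  forall i, (i.+1 < n)%N -> (t i @: U <= U)%VS.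

Definition dsummand n (M : vectType F) (t : nat -> 'End(M)) (U : {vspace M}) : Prop :=
  submod n t U /\ exists U' : {vspace M},
    submod n t U' /\ directv (U + U') /\ (U + U')%VS = fullv.

Definition indecomposable n (M : vectType F) (t : nat -> 'End(M)) (U : {vspace M}) : Prop :=
  U != 0%VS /\
  forall A B : {vspace M}, submod n t A -> submod n t B ->
    directv (A + B) -> (A + B)%VS = U -> A = 0%VS \/ B = 0%VS.

Definition iso_to_summand n (M N : vectType F) (t : nat -> 'End(M)) (s : nat -> 'End(N))
    (U : {vspace M}) : Prop :=
  exists P Q : {vspace N}, submod n s P /\ submod n s Q /\
    directv (P + Q) /\ (P + Q)%VS = fullv /\
    exists f : 'Hom(M, N),
      (forall i, (i.+1 < n)%N -> forall x, x \in U -> f (t i x) = s i (f x)) /\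
      (f @: U)%VS = P /\ (lker f :&: U)%VS = 0%VS.

(* compositions and parabolic subalgebras: H_lambda is generated by the t j with
   j+1 (the paper's 1-based index) not a partial sum lambda_1 + ... + lambda_k *)
Definition composition (n : nat) (la : seq nat) : Prop :=
  all (fun k => 0 < k)%N la /\ sumn la = n.

Definition parab (n : nat) (la : seq nat) (j : nat) : bool :=
  (j.+1 < n)%N && (j.+1 \notin scanl addn 0%N la).

Definition onedim_rep (n : nat) (q : F) (la : seq nat) (chi : nat -> F) : Prop :=
  (forall j, parab n la j -> (chi j - q) * (chi j + 1) = 0) /\
  (forall j, parab n la j -> parab n la j.+1 ->
     chi j * chi j.+1 * chi j = chi j.+1 * chi j * chi j.+1).

(* (M, t, m) is the induced module H_n (x)_{H_lambda} F_chi (with m = 1 (x) 1),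
   characterised by its universal property among finite dimensional H_n-modules. *)
Definition induced (n : nat) (q : F) (la : seq nat) (chi : nat -> F)
    (M : vectType F) (t : nat -> 'End(M)) (m : M) : Prop :=
  hmod n q t /\ (forall j, parab n la j -> t j m = chi j *: m) /\
  forall (N : vectType F) (s : nat -> 'End(N)) (v : N),
    hmod n q s -> (forall j, parab n la j -> s j v = chi j *: v) ->
    exists! phi : 'Hom(M, N),
      (forall i, (i.+1 < n)%N -> forall x, phi (t i x) = s i (phi x)) /\ phi m = v.

Definition Tfam n (R : 'End(tens 2)) : nat -> 'End(tens n) := fun i => Top n R i.

Definition onedim_source (q : F) (R : 'End(tens 2)) : Prop :=
  forall n, (0 < n)%N -> forall U : {vspace tens n},
    dsummand n (Tfam n R) U -> indecomposable n (Tfam n R) U ->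
    exists (la : seq nat) (chi : nat -> F),
      composition n la /\ onedim_rep n q la chi /\
      exists (M : vectType F) (t : nat -> 'End(M)) (m : M),
        induced n q la chi t m /\ iso_to_summand n (Tfam n R) t U.

(* ---- quadratic algebras  A = T(V)/(I),  I <= V (x) V ----
   W m i is the subspace V^{(x) i} (x) I (x) V^{(x) (m-i-2)} of V^{(x) m}. *)
Definition qfam := forall m : nat, nat -> {vspace tens m}.

(* S(V,R): I = Im(R - q id);  V^i (x) I (x) V^.. = Im(T_i - q id) *)
Definition Sfam (q : F) (R : 'End(tens 2)) : qfam :=
  fun m i => limg (Top m R i - q *: \1%VF).
(* Lambda(V,R): I = Ker(R - q id);  V^i (x) I (x) V^.. = Ker(T_i - q id) *)
Definition Lfam (q : F) (R : 'End(tens 2)) : qfam :=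
  fun m i => lker (Top m R i - q *: \1%VF).

Definition ideal_deg (W : qfam) (m : nat) : {vspace tens m} :=
  (\sum_(i < m.-1) W m i)%VS.

Definition hilb (W : qfam) (m : nat) : nat :=
  (\dim (fullv : {vspace tens m}) - \dim (ideal_deg W m))%N.

(* Right Koszul complex  ... -> A^!_p (x) A -> A^!_{p-1} (x) A -> ... -> A -> k,
   in internal degree m.  With A^!_p = \bigcap_{i<p-1} (V^i (x) I (x) V^{p-i-2}) <= V^p,
   the term A^!_p (x) A_{m-p} is the subquotient  Zc m p / Bd m p  of V^{(x) m}, where
     Zc m p = A^!_p (x) V^{(x)(m-p)}   and   Bd m p = A^!_p (x) I_{m-p},
   and the differential is induced by the identity of V^{(x) m}. *)
Definition Zc (W : qfam) (m p : nat) : {vspace tens m} :=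
  (\bigcap_(i < p.-1) W m i)%VS.
Definition Bd (W : qfam) (m p : nat) : {vspace tens m} :=
  (Zc W m p :&: \sum_(p <= j < m.-1) W m j)%VS.
(* kernel of the differential out of homological degree p (p = 0: augmentation,
   which is zero in internal degree m >= 1) *)
Definition Kker (W : qfam) (m p : nat) : {vspace tens m} :=
  if p is p'.+1 then (Zc W m p :&: Bd W m p')%VS else fullv.
(* Koszul: the augmented complex is exact in every internal degree m >= 1 at every
   homological degree 0 <= p <= m (in degree 0 it is k -> k, trivially exact). *)
Definition koszul (W : qfam) : Prop :=
  forall m p, (0 < m)%N -> (p <= m)%N ->
    (Kker W m p <= Zc W m p.+1 + Bd W m p)%VS.

Definition hilb_inverse (W W' : qfam) : Prop :=
  forall m, \sum_(i < m.+1) (-1) ^+ i * ((hilb W i)%:Z * (hilb W' (m - i))%:Z)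
            = (m == 0%N)%:Z :> int.

End HeckeKoszul.

(* Main.v *)
Require Import Defs.
From HB Require Import structures.
From mathcomp Require Import all_boot all_order all_algebra zify ring.
From Stdlib Require Import Classical_Prop.

(** The induced modules of the source condition are modelled on words: fix letters
    with eigenvalues [c a] in [{q, -1}] and let [T_i] act on words of length [n] by
    the standard (super) R-matrix. An induced module from a one-dimensional
    representation of a parabolic subalgebra is a retract of such a word module, so
    the identity of V^(x)n is a sum of endomorphisms factoring equivariantly through
    word modules.

    Koszulness in degree [n] says that the subspaces [W_i = Im (T_i - q)] (resp.
    [Ker (T_i - q)]) satisfy [X :&: (W_p + Z) <= X :&: W_p + X :&: Z] where
    [X = \bigcap_(i < p) W_i] and [Z = \sum_(j > p) W_j]; this passes through such
    factorizations. On a word module it holds because there is a basis [b_w] such that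
    every [W_i] is spanned by the [b_w] with a descent at [i].

    For the Hilbert series, exactness of the Koszul complex of S(V,R) gives the
    identity with [dim (\bigcap_i Im (T_i - q))] in place of [dim Lambda_n]. Equality of
    the two dimensions reduces to the following: an endomorphism [E] of a weight component of a
    word module acts on the lines [\bigcap_i Im (T_i - q)] and [N / \sum_i Ker (T_i - q)]
    by the same scalar. For generic [q] the first line maps isomorphically onto the second;
    in general [E] is deformed to an endomorphism over [F(t)] specializing to [E] at
    [t = q]. *)

Set Implicit Arguments. Unset Strict Implicit. Unset Printing Implicit Defensive.

(** * Words *)

Section Words.
Variables (k n' : nat).
Local Notation n := n'.+1.
Implicit Types (u w : word k n) (f g : nat -> nat).

Definition letter w (j : nat) : 'I_k := w (inord j).

Definition swn (i j : nat) : nat :=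
  if j == i then i.+1 else if j == i.+1 then i else j.

Definition sw (i : nat) w : word k n := [ffun j : 'I_n => letter w (swn i j)].

Lemma swn_lt i j : i.+1 < n -> j < n -> swn i j < n.
Proof. by rewrite /swn; case: eqP => _; [|case: eqP => _]; lia. Qed.

Lemma swnK i : involutive (swn i).
Proof. by move=> j; rewrite /swn; repeat case: eqP; lia. Qed.

Lemma letter_sw i w j : j < n -> letter (sw i w) j = letter w (swn i j).
Proof. by move=> jn; rewrite /letter /sw ffunE /letter inordK. Qed.

Lemma letterP u w : (forall j, j < n -> letter u j = letter w j) -> u = w.
Proof.
by move=> uw; apply/ffunP=> j; have := uw j (ltn_ord j); rewrite /letter inord_val.
Qed.

Lemma letter_swl i w : i.+1 < n -> letter (sw i w) i = letter w i.+1.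
Proof. by move=> h; rewrite letter_sw 1?ltnW// /swn eqxx. Qed.

Lemma letter_swr i w : i.+1 < n -> letter (sw i w) i.+1 = letter w i.
Proof. by move=> h; rewrite letter_sw// /swn eqxx; case: eqP => //; lia. Qed.

Lemma letter_swN i j w : j < n -> j != i -> j != i.+1 ->
  letter (sw i w) j = letter w j.
Proof. by move=> h /negbTE ji /negbTE jj; rewrite letter_sw// /swn ji jj. Qed.

Lemma swK i : i.+1 < n -> involutive (sw i).
Proof.
by move=> h w; apply: letterP => j jn; rewrite !letter_sw ?swnK// swn_lt.
Qed.

Lemma swC i j w : i.+1 < j -> j.+1 < n -> sw i (sw j w) = sw j (sw i w).
Proof.
move=> h hj; have hi : i.+1 < n by lia.
apply: letterP => l ln; rewrite !letter_sw ?swn_lt//; congr (letter w _).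
by rewrite /swn; repeat (case: eqP => //); lia.
Qed.

Lemma sw_braid i w : i.+2 < n ->
  sw i (sw i.+1 (sw i w)) = sw i.+1 (sw i (sw i.+1 w)).
Proof.
move=> h; have hi : i.+1 < n by lia.
apply: letterP => l ln; rewrite !letter_sw ?swn_lt//; congr (letter w _).
by rewrite /swn; repeat (case: eqP => //); lia.
Qed.

Lemma sw_eq i w : i.+1 < n -> letter w i = letter w i.+1 -> sw i w = w.
Proof.
move=> h e; apply: letterP => j jn; rewrite letter_sw// /swn.
by case: eqP => [->|_]; [|case: eqP => [->|]].
Qed.

Definition ninv w : nat :=
  \sum_(p : 'I_n * 'I_n) ((p.1 < p.2) && (w p.2 < w p.1)).

(** Reindexing the pairs of positions by the transposition alters the summand only at the pair [x],
    which becomes a new inversion. *)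
Lemma ninv_sw i w : i.+1 < n -> letter w i < letter w i.+1 ->
  ninv (sw i w) = (ninv w).+1.
Proof.
move=> h lt.
pose s (j : 'I_n) : 'I_n := inord (swn i j).
have vs j : s j = swn i j :> nat by rewrite /= inordK ?swn_lt.
have sK : involutive s by move=> j; apply: val_inj; rewrite /= !vs swnK.
pose s2 (p : 'I_n * 'I_n) := (s p.1, s p.2).
have s2K : involutive s2 by move=> [a b]; rewrite /s2 /= !sK.
pose x : 'I_n * 'I_n := (inord i.+1, inord i).
rewrite /ninv (reindex_inj (inv_inj s2K)) /=.
rewrite (eq_bigr (fun p : 'I_n * 'I_n =>
   ((p.1 < p.2) && (w p.2 < w p.1)) + (p == x))); last first.
  move=> [a b] _ /=; rewrite !ffunE /letter -!/(s _) !sK !vs.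
  rewrite /x xpair_eqE.
  have -> : (a == inord i.+1) = (a == i.+1 :> nat).
    by rewrite -(inj_eq val_inj) /= inordK.
  have -> : (b == inord i) = (b == i :> nat).
    by rewrite -(inj_eq val_inj) /= inordK // ltnW.
  have Ea : a = i.+1 :> nat -> w a = letter w i.+1.
    by move=> e; rewrite /letter -e inord_val.
  have Eb : b = i :> nat -> w b = letter w i.
    by move=> e; rewrite /letter -e inord_val.
  have Ea' : a = i :> nat -> w a = letter w i.
    by move=> e; rewrite /letter -e inord_val.
  have Eb' : b = i.+1 :> nat -> w b = letter w i.+1.
    by move=> e; rewrite /letter -e inord_val.
  case: (eqVneq (a : nat) i.+1) (eqVneq (b : nat) i) => [ea|na] [eb|nb];
    rewrite ?addn0.
  - by rewrite Ea // Eb // lt ea eb /swn !eqxx; repeat case: eqP; lia.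
  - congr (nat_of_bool (_ && _)); rewrite ea /swn !eqxx.
    by move/eqP: nb; repeat case: eqP; lia.
  - congr (nat_of_bool (_ && _)); rewrite eb /swn !eqxx.
    by move/eqP: na; repeat case: eqP; lia.
  case: (eqVneq (a : nat) i) (eqVneq (b : nat) i.+1) => [ea|na'] [eb|nb'].
  - by rewrite Ea' // Eb' // (ltnNge (letter w i.+1)) (ltnW lt) !andbF.
  - congr (nat_of_bool (_ && _)); rewrite ea /swn !eqxx.
    by move/eqP: nb; move/eqP: nb'; repeat case: eqP; lia.
  - congr (nat_of_bool (_ && _)); rewrite eb /swn !eqxx.
    by move/eqP: na; move/eqP: na'; repeat case: eqP; lia.
  congr (nat_of_bool (_ && _)); rewrite /swn.
  by rewrite (negbTE na) (negbTE nb) (negbTE na') (negbTE nb').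
rewrite big_split /= -/(ninv w).
by rewrite (bigD1 x)//= eqxx big1 ?addn0 ?addn1 // => p /negbTE ->.
Qed.

Lemma ninv_swD i w : i.+1 < n -> letter w i.+1 < letter w i ->
  ninv w = (ninv (sw i w)).+1.
Proof.
move=> h lt; rewrite -[in LHS](swK h w) ninv_sw//.
by rewrite letter_swl// letter_swr.
Qed.

Lemma perm_mkseq_swn (T : eqType) (f : nat -> T) i : i.+1 < n ->
  perm_eq (mkseq (f \o swn i) n) (mkseq f n).
Proof.
move=> h; rewrite /mkseq map_comp; apply: perm_map.
have inj : injective (swn i) by apply: inv_inj; exact: swnK.
have mi j : (j \in iota 0 n) = (j < n) by rewrite mem_iota.
apply: uniq_perm; rewrite ?map_inj_uniq ?iota_uniq// => j.
rewrite mi; apply/mapP/idP => [[l] | jn].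
  by rewrite mi => ln ->; rewrite swn_lt.
by exists (swn i j); rewrite ?swnK// mi swn_lt.
Qed.

(** Equality of multisets as an explicit injection of positions, the form needed to trace repeated
    values from one word to another. *)
Lemma perm_mkseqP f g : perm_eq (mkseq f n) (mkseq g n) ->
  exists s : nat -> nat, [/\ forall j, j < n -> s j < n,
    forall j, j < n -> f j = g (s j) &
    forall i j, i < n -> j < n -> s i = s j -> i = j].
Proof.
move=> /(perm_iotaP 0) [Is pI eI]; rewrite size_mkseq in pI.
have szI : size Is = n by rewrite (perm_size pI) size_iota.
have uI : uniq Is by rewrite (perm_uniq pI) iota_uniq.
have lI j : j < n -> nth 0 Is j < n.
  move=> jn; have : nth 0 Is j \in Is by rewrite mem_nth ?szI.
  by rewrite (perm_mem pI) mem_iota.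
exists (nth 0 Is); split=> // [j jn|i j ni nj /eqP].
  have := congr1 (fun s => nth 0 s j) eI.
  by rewrite /= nth_mkseq// (nth_map 0) ?szI// nth_mkseq// lI.
by rewrite nth_uniq ?szI// => /eqP.
Qed.

Lemma sorted_mkseq_inj f g : perm_eq (mkseq f n) (mkseq g n) ->
  (forall i, i.+1 < n -> f i <= f i.+1) ->
  (forall i, i.+1 < n -> g i <= g i.+1) -> forall j, j < n -> f j = g j.
Proof.
move=> p sf sg j jn.
have so h : (forall i, i.+1 < n -> h i <= h i.+1) -> sorted leq (mkseq h n).
  move=> sh; apply/(sortedP 0) => i; rewrite size_mkseq => hi.
  by rewrite !nth_mkseq ?sh// ltnW.
have := sorted_eq leq_trans anti_leq (so f sf) (so g sg) p.
by move/(congr1 (fun s => nth 0 s j)); rewrite !nth_mkseq.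
Qed.

(** Same content: the classes are the orbits of words under permutation of positions, and they index
    the weight components. *)
Definition csame u w : bool :=
  perm_eq (mkseq (fun j => val (letter u j)) n) (mkseq (fun j => val (letter w j)) n).

Lemma csame_refl w : csame w w. Proof. exact: perm_refl. Qed.

Lemma csame_sw i u w : i.+1 < n -> csame (sw i u) w = csame u w.
Proof.
move=> h; apply: permPl; have := perm_mkseq_swn (fun j => val (letter u j)) h.
congr (perm_eq _ _); apply/eq_in_map => j; rewrite mem_iota => /andP [_ jn].
by rewrite /= letter_sw.
Qed.

Definition wsorted w := forall i, i.+1 < n -> letter w i <= letter w i.+1.

Lemma wsorted_inj u w : wsorted u -> wsorted w -> csame u w -> u = w.
Proof.
move=> su sw_ c; apply: letterP => j jn; apply: val_inj.
exact: (sorted_mkseq_inj c su sw_ jn).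
Qed.

Lemma wsorted_homo w : wsorted w -> forall i j, i <= j -> j < n ->
  letter w i <= letter w j.
Proof.
move=> s i j ij; elim: j ij => [|j IH] ij jn; first by have -> : i = 0 by lia.
case: (ltngtP i j.+1) ij => // [ij _|-> _ //].
by apply: leq_trans (s j jn); apply: IH; lia.
Qed.

(** The two equal letters come from two distinct positions of [v]; a sorted word is constant between
    them, so adjacent positions serve as well. *)
Lemma csame_repeat v w i : csame w v -> wsorted v -> i.+1 < n ->
  letter w i = letter w i.+1 ->
  exists j, [/\ j.+1 < n, letter v j = letter w i & letter v j.+1 = letter w i].
Proof.
move=> c sv h e.
have [s [sn se sinj]] := perm_mkseqP c.
have hi : i < n by lia.
have e0 : letter v (s i) = letter w i by apply: val_inj; rewrite -se.
have e1 : letter v (s i.+1) = letter w i by apply: val_inj; rewrite -se // e.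
have [a [b [ab bn ea eb]]] : exists a b, [/\ a < b, b < n,
    letter v a = letter w i & letter v b = letter w i].
  case: (ltngtP (s i) (s i.+1)) => [lt|lt|/sinj eq].
  - by exists (s i), (s i.+1); split=> //; exact: sn.
  - by exists (s i.+1), (s i); split=> //; exact: sn.
  - by have := eq hi h; lia.
exists a; split=> //; first by lia.
apply: val_inj; apply/eqP; rewrite eqn_leq /=.
rewrite -{1}eb -ea wsorted_homo//=; try lia.
by apply: sv; lia.
Qed.

Lemma has_descent w :
  wsorted w \/ exists2 i, i.+1 < n & letter w i.+1 < letter w i.
Proof.
case: (pickP (fun i : 'I_n => (i.+1 < n) && (letter w i.+1 < letter w i))).
  by move=> i /andP [h1 h2]; right; exists i.
move=> H; left=> i hi; have /negbT := H (Ordinal (ltnW hi)).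
by rewrite /= hi /= -leqNgt.
Qed.

(* Induction on the number of inversions: every word is reached from a sorted
   one by swapping ascents. *)
Lemma word_ind (P : word k n -> Prop) :
  (forall w, wsorted w -> P w) ->
  (forall w i, i.+1 < n -> letter w i.+1 < letter w i -> P (sw i w) -> P w) ->
  forall w, P w.
Proof.
move=> P0 PS w; have [m] := ubnP (ninv w); elim: m w => // m IH w lw.
have [/P0 //|[i h lt]] := has_descent w.
by apply: (PS w i) => //; apply: IH; move: lw; rewrite (ninv_swD h lt); lia.
Qed.

(** A crude bound, enough to make [n * n - ninv w] an honest difference, both as an exponent and as
    a measure for descending induction. *)
Lemma ninv_le w : ninv w <= n * n.
Proof.
apply: (@leq_trans (\sum_(p : 'I_n * 'I_n) 1)).
  by apply: leq_sum => p _; case: (_ && _).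
by rewrite sum1_card card_prod card_ord.
Qed.

Lemma wsorted_ninv0 w : ninv w = 0 -> wsorted w.
Proof. by move=> e; case: (has_descent w) => // -[i h]; move/(ninv_swD h); rewrite e. Qed.

Lemma ninv_wsorted w : wsorted w -> ninv w = 0.
Proof.
move=> s; apply: big1 => -[a b] _ /=; case: ltnP => //= ab.
have := wsorted_homo s (ltnW ab) (ltn_ord b).
by rewrite /letter !inord_val leqNgt => /negbTE ->.
Qed.

End Words.

Import GRing.Theory.
Local Open Scope ring_scope.

(** * Word modules *)

Lemma linfun_linE (F : fieldType) (U V : vectType F) (f : U -> V) :
  linear f -> linfun f =1 f.
Proof.
move=> lf; pose L : {linear U -> V} := HB.pack f (GRing.isLinear.Build F U V *:%R f lf).
exact: (lfunE L).
Qed.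

Section BasisVectors.
Variables (F : fieldType) (I : finType).
Local Notation T := {ffun I -> F^o}.

Definition ev (w : I) : T := [ffun u => (u == w)%:R].

Lemma ev_expand (x : T) : x = \sum_w x w *: ev w.
Proof.
apply/ffunP => u; rewrite sum_ffunE (bigD1 u)//= big1 => [|w /negbTE wu].
  by rewrite !ffunE eqxx addr0 [RHS]mulr1.
by rewrite !ffunE eq_sym wu [LHS]mulr0.
Qed.

Lemma lfun_ev_ext (V : vectType F) (f g : 'Hom(T, V)) :
  (forall w, f (ev w) = g (ev w)) -> f = g.
Proof.
move=> fg; apply/lfunP => x; rewrite (ev_expand x) !linear_sum /=.
by apply: eq_bigr => w _; rewrite !linearZ /= fg.
Qed.

Definition ffun_lin (V : vectType F) (m : I -> V) : 'Hom(T, V) :=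
  linfun (fun x : T => \sum_w x w *: m w).

Lemma ffun_linE (V : vectType F) (m : I -> V) x : ffun_lin m x = \sum_w x w *: m w.
Proof.
apply: (@linfun_linE F T V) => a y z; rewrite scaler_sumr -big_split /=.
by apply: eq_bigr => w _; rewrite !ffunE scalerDl scalerA.
Qed.

Lemma ffun_lin_ev (V : vectType F) (m : I -> V) w : ffun_lin m (ev w) = m w.
Proof.
rewrite ffun_linE (bigD1 w)//= big1 => [|u /negbTE uw].
  by rewrite ffunE eqxx scale1r addr0.
by rewrite ffunE uw scale0r.
Qed.
End BasisVectors.

Definition equivariant (F : fieldType) n (M N : vectType F) (t : nat -> 'End(M))
    (s : nat -> 'End(N)) (f : 'Hom(M, N)) :=
  forall i, (i.+1 < n)%N -> forall x, f (t i x) = s i (f x).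

Section WordModule.
Variables (F : fieldType) (q : F) (k n' : nat) (c : 'I_k -> F).
Local Notation n := n'.+1.
Local Notation N := (tens F k n).
Hypothesis hc : forall a, (c a - q) * (c a + 1) = 0.
Implicit Types (u w : word k n) (x : N).

(* On basis vectors the action reads [T e_ab = e_ba] and [T e_ba = q e_ab + (q - 1) e_ba]
   for [a < b], and [T e_aa = c a e_aa]; [pcf] and [qcf] are its coefficients in
   coordinates. *)
Definition pcf (a b : 'I_k) : F :=
  if (a < b)%N then 0 else if (b < a)%N then q - 1 else c a.
Definition qcf (a b : 'I_k) : F :=
  if (a < b)%N then q else if (b < a)%N then 1 else 0.

Definition wT (i : nat) : 'End(N) :=
  linfun (fun x : N => [ffun w : word k n =>
    pcf (letter w i) (letter w i.+1) * x w +
    qcf (letter w i) (letter w i.+1) * x (sw i w) : F^o] : N).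

Lemma wTE i x w : wT i x w = pcf (letter w i) (letter w i.+1) * x w +
    qcf (letter w i) (letter w i.+1) * x (sw i w).
Proof.
rewrite /wT linfun_linE ?ffunE // => a y z; apply/ffunP => u; rewrite !ffunE.
rewrite /GRing.scale /=; ring.
Qed.

Lemma wT_ev i w : (i.+1 < n)%N ->
  wT i (ev F w) =
    if (letter w i < letter w i.+1)%N then ev F (sw i w)
    else if (letter w i.+1 < letter w i)%N then q *: ev F (sw i w) + (q - 1) *: ev F w
    else c (letter w i) *: ev F w.
Proof.
move=> h; apply/ffunP => u; rewrite wTE !ffunE.
have E : (sw i u == w) = (u == sw i w).
  by apply/eqP/eqP => [<-|->]; rewrite swK.
rewrite E /pcf /qcf.
have [uw|nuw] := eqVneq u w.
  rewrite uw; case: ltngtP => [lt|gt|/val_inj e]; rewrite ?ffunE.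
  - by rewrite mul0r add0r eq_sym; case: eqP => [e|_]; rewrite ?mulr0 //;
      move: lt; rewrite -letter_swl // e ltnn.
  - by rewrite eq_sym; case: eqP => [e|_];
      [move: gt; rewrite -letter_swl // e ltnn |
       rewrite eqxx mulr0 addr0 [X in _ = X + _]mulr0 add0r].
  - by rewrite eqxx mul0r addr0.
have [us|nus] := eqVneq u (sw i w).
  have nw : sw i w != w by rewrite -us.
  rewrite us letter_swl // letter_swr // !mulr1 mulr0 add0r.
  case: ltngtP => [lt|gt|/val_inj e]; rewrite !ffunE ?eqxx ?(negbTE nw) //.
  - by rewrite [X in _ = _ + X]mulr0 addr0 [RHS]mulr1.
  - by move: nw; rewrite sw_eq ?eqxx.
rewrite !mulr0 addr0.
by case: ifP => _; rewrite ?ffunE ?(negbTE nus) //;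
  case: ifP => _; rewrite !ffunE ?(negbTE nus) (negbTE nuw) ?scaler0 ?addr0.
Qed.

Lemma wT_hmod : hmod n q wT.
Proof.
split; [|split].
- move=> i h x; apply/ffunP => w.
  rewrite !(wTE, ffunE) letter_swl// letter_swr// swK// /pcf /qcf /GRing.scale /=.
  case: ltngtP => [lt|gt|/val_inj e]; try by ring.
  transitivity ((c (letter w i) - q) * (c (letter w i) + 1) * x w).
    by ring.
  by rewrite hc mul0r.
- move=> i h x; apply/ffunP => w.
  have h1 : (i.+1 < n)%N by lia.
  rewrite !wTE.
  have L0 (v : word k n) : letter (sw i v) i.+2 = letter v i.+2 by rewrite letter_swN //; apply/eqP; lia.
  have L1 (v : word k n) : letter (sw i.+1 v) i = letter v i by rewrite letter_swN //; lia.
  rewrite !(L0, L1, letter_swl, letter_swr) // !swK // sw_braid //.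
  rewrite /pcf /qcf.
  move: (letter w i) (letter w i.+1) (letter w i.+2) => a1 a2 a3.
  have := hc a1; have := hc a2; have := hc a3.
  case: (ltngtP a1 a2) => [?|?|/val_inj ?]; case: (ltngtP a2 a3) => [?|?|/val_inj ?]; 
  case: (ltngtP a1 a3) => [?|?|/val_inj ?]; subst; try lia; move=> E3 E2 E1; try ring.
  (* In the two cases that [ring] leaves, the sides differ by a multiple of the quadratic expression
     of a letter. *)
  - apply: subr0_eq; transitivity (- (q - 1) * ((c a3 - q) * (c a3 + 1)) * x w); first by ring.
    by rewrite hc mulr0 mul0r.
  - apply: subr0_eq; transitivity ((q - 1) * ((c a2 - q) * (c a2 + 1)) * x w); first by ring.
    by rewrite hc mulr0 mul0r.
- move=> i j hi hj ij x; apply/ffunP => w; rewrite !wTE.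
  have L (v : word k n) : ((letter (sw j v) i = letter v i) * (letter (sw j v) i.+1 = letter v i.+1) *
      (letter (sw i v) j = letter v j) * (letter (sw i v) j.+1 = letter v j.+1))%type.
    by rewrite !letter_swN //; lia.
  by rewrite !L (swC w ij hj); ring.
Qed.

(** * Equivariant maps out of a word module, prescribed on sorted words *)

Section Universal.
Variables (M : vectType F) (t : nat -> 'End(M)) (base : word k n -> M).
Hypothesis tH : hmod n q t.
Hypothesis base_eq : forall w, wsorted w -> forall i, (i.+1 < n)%N ->
  letter w i = letter w i.+1 -> t i (base w) = c (letter w i) *: base w.

Definition descent w (i : nat) := (i.+1 < n)%N && (letter w i.+1 < letter w i)%N.

(** The intended image of the basis vector of [w]: descents are undone until the word is sorted, and
    the operators met on the way are applied to the vector prescribed there. With fuel [ninv w] the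
    recursion stops exactly at a sorted word. *)
Fixpoint mrec (fuel : nat) w : M :=
  if fuel is f.+1 then
    if [pick i : 'I_n | descent w i] is Some i then t i (mrec f (sw i w)) else base w
  else base w.

Definition mw w := mrec (ninv w) w.

Lemma mw_pick w : (wsorted w /\ mw w = base w) \/
  (exists2 i, descent w i & mw w = t i (mw (sw i w))).
Proof.
have [s|[j h lt]] := has_descent w.
  by left; rewrite /mw ninv_wsorted.
right; rewrite /mw (ninv_swD h lt) /=; case: pickP => [i di|H]; last first.
  by have := H (Ordinal (ltnW h)); rewrite /descent /= h lt.
exists i => //; case/andP: di => h1 lt1.
by have := ninv_swD h lt; rewrite (ninv_swD h1 lt1) => -[->].
Qed.

(* Confluence: two descents of a word are resolved by commutation or by the
   braid relation, so the choice made in [mrec] is immaterial. *)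
Lemma mw_diamond w i j : descent w i -> descent w j -> (i < j)%N ->
  (forall u, (ninv u < ninv w)%N -> forall l, descent u l -> mw u = t l (mw (sw l u))) ->
  t i (mw (sw i w)) = t j (mw (sw j w)).
Proof.
move=> /andP [hi di] /andP [hj dj] ij IH; have [_ [tB tC]] := tH.
have li : (ninv (sw i w) < ninv w)%N by rewrite (ninv_swD hi di).
have lj : (ninv (sw j w) < ninv w)%N by rewrite (ninv_swD hj dj).
case: (ltngtP i.+1 j) ij => // [ij|eij] _.
  rewrite (IH _ li j); last by rewrite /descent hj !letter_swN //; lia.
  rewrite (IH _ lj i); last by rewrite /descent hi !letter_swN //; lia.
  by rewrite (swC w ij hj) tC.
subst j.
have L0 (v : word k n) : letter (sw i v) i.+2 = letter v i.+2 by rewrite letter_swN //; lia.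
have L1 (v : word k n) : letter (sw i.+1 v) i = letter v i by rewrite letter_swN //; lia.
have dd : (letter w i.+2 < letter w i)%N by apply: ltn_trans di.
have E1 : descent (sw i w) i.+1 by rewrite /descent hj L0 letter_swr.
have E2 : descent (sw i.+1 (sw i w)) i.
  by rewrite /descent hi L1 letter_swl // letter_swl // L0.
have E3 : descent (sw i.+1 w) i by rewrite /descent hi L1 letter_swl.
have E4 : descent (sw i (sw i.+1 w)) i.+1.
  by rewrite /descent hj L0 letter_swr // letter_swr // L1.
have inv_lt u l : descent u l -> (ninv u < ninv w)%N -> (ninv (sw l u) < ninv w)%N.
  by move=> /andP [h1 h2]; apply: leq_ltn_trans; rewrite (ninv_swD h1 h2).
rewrite (IH _ li _ E1) (IH _ (inv_lt _ _ E1 li) _ E2).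
rewrite (IH _ lj _ E3) (IH _ (inv_lt _ _ E3 lj) _ E4).
by rewrite tB // sw_braid.
Qed.

(** As in Newman's lemma: by induction on inversions, local confluence makes any descent as good as
    the one picked. *)
Lemma mw_descent w i : descent w i -> mw w = t i (mw (sw i w)).
Proof.
have [m] := ubnP (ninv w); elim: m w i => // m IH w i lw di.
have IH' u : (ninv u < ninv w)%N -> forall l, descent u l -> mw u = t l (mw (sw l u)).
  by move=> lu l; apply: IH; apply: leq_trans lu _.
case: (mw_pick w) => [[s _]|[j dj ->]].
  by case/andP: di => h; rewrite ltnNge s.
case: (ltngtP i j) => [ij|ij|-> //].
  by rewrite (mw_diamond di dj ij).
by rewrite (mw_diamond dj di ij).
Qed.

(** Induction on inversions. The operator [t i] is moved past the picked descent: directly if it is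
    far away, by the braid relation if it is adjacent, in which case the equal letters have shifted
    to the neighbouring pair of positions. *)
Lemma mw_same w i : (i.+1 < n)%N -> letter w i = letter w i.+1 ->
  t i (mw w) = c (letter w i) *: mw w.
Proof.
have [m] := ubnP (ninv w); elim: m w i => // m IH w i lw hi e.
have [_ [tB tC]] := tH.
case: (mw_pick w) => [[s ->]|[j dj]]; first exact: base_eq.
have /andP [hj ltj] := dj.
have lj : (ninv (sw j w) < m)%N by move: lw; rewrite (ninv_swD hj ltj).
case: (ltngtP i j) => [ij|ij|eij]; last by move: ltj; rewrite -eij e ltnn.
- case: (ltngtP i.+1 j) ij => // [ij|eij] _.
    move=> ->; rewrite tC // IH //; last by rewrite !letter_swN //; lia.
    by rewrite linearZ /= letter_swN //; lia.
  subst j.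
  have L0 (v : word k n) : letter (sw i v) i.+2 = letter v i.+2 by rewrite letter_swN //; lia.
  have L1 (v : word k n) : letter (sw i.+1 v) i = letter v i by rewrite letter_swN //; lia.
  have d2 : descent (sw i.+1 w) i by rewrite /descent hi L1 letter_swl // e.
  have l2 : (ninv (sw i (sw i.+1 w)) < m)%N.
    by move: lj; case/andP: d2 => h2 d2; rewrite (ninv_swD h2 d2); lia.
  move=> ->; rewrite (mw_descent d2) tB // IH //.
    by rewrite letter_swr // L1 !linearZ.
  by rewrite L0 !letter_swr // L1 e.
case: (ltngtP j.+1 i) ij => // [ij|eij] _.
  move=> ->; rewrite -tC // IH //; last by rewrite !letter_swN //; lia.
  by rewrite linearZ /= letter_swN //; lia.
subst i.
have L0 (v : word k n) : letter (sw j v) j.+2 = letter v j.+2 by rewrite letter_swN //; lia.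
have L1 (v : word k n) : letter (sw j.+1 v) j = letter v j by rewrite letter_swN //; lia.
have d2 : descent (sw j w) j.+1 by rewrite /descent hi L0 letter_swr // -e.
have l2 : (ninv (sw j.+1 (sw j w)) < m)%N.
  by move: lj; case/andP: d2 => h2 d2; rewrite (ninv_swD h2 d2); lia.
move=> ->; rewrite (mw_descent d2) -tB // IH //.
  by rewrite L1 letter_swl // !linearZ.
by rewrite L1 !letter_swl // L0 e.
Qed.

Definition wpsi : 'Hom(N, M) := ffun_lin mw.

Lemma wpsi_equivariant : equivariant n wT t wpsi.
Proof.
move=> i h x; have [tQ _] := tH.
rewrite -!comp_lfunE; congr (fun_of_lfun _ x); apply: lfun_ev_ext => w.
rewrite !comp_lfunE wT_ev // [in RHS]/wpsi ffun_lin_ev.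
case: ltngtP => [lt|gt|/val_inj e].
- rewrite ffun_lin_ev (@mw_descent (sw i w) i) ?swK //.
  by rewrite /descent h letter_swl // letter_swr.
- rewrite linearD !linearZ /= !ffun_lin_ev.
  have -> : mw w = t i (mw (sw i w)) by apply: mw_descent; rewrite /descent h.
  (* The quadratic relation of [M] expresses [t i (t i y)] through [t i y] and [y], where
     [y = mw (sw i w)], with the coefficients of [wT_ev] at a descent. *)
  have := tQ i h (mw (sw i w)); rewrite linearD /= => /eqP; rewrite subr_eq0 => /eqP E.
  have -> : t i (t i (mw (sw i w))) = q *: (t i (mw (sw i w)) + mw (sw i w)) - t i (mw (sw i w)).
    by rewrite -E addrK.
  by rewrite scalerDr scalerBl scale1r addrA [q *: _ + q *: _]addrC.
- by rewrite linearZ /= ffun_lin_ev mw_same.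
Qed.

Lemma wpsi_sorted w : wsorted w -> wpsi (ev F w) = base w.
Proof. by move=> s; rewrite ffun_lin_ev /mw ninv_wsorted. Qed.

End Universal.
End WordModule.

(** * The adapted basis *)

Section SumNat.
Variables (F : fieldType) (V : vectType F).

Lemma memv_sum_nat (W : nat -> {vspace V}) a b j v :
  (a <= j < b)%N -> v \in W j -> v \in (\sum_(a <= i < b) W i)%VS.
Proof.
move=> jab vW; rewrite (bigD1_seq j) ?mem_index_iota ?iota_uniq //=.
by rewrite -[v]addr0 memv_add // mem0v.
Qed.

Lemma sumv_nat_ind (Q : V -> Prop) (W : nat -> {vspace V}) a b :
  Q 0 -> (forall x y, Q x -> Q y -> Q (x + y)) ->
  (forall j, (a <= j < b)%N -> forall v, v \in W j -> Q v) ->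
  forall v, v \in (\sum_(a <= i < b) W i)%VS -> Q v.
Proof.
move=> Q0 QD QW; rewrite big_nat_cond.
elim/big_ind: _ => [v|A B QA QB v /memv_addP [x xA [y yB ->]]|j].
- by rewrite memv0 => /eqP ->.
- by apply: QD; [apply: QA|apply: QB].
- by rewrite andbT => /QW.
Qed.
End SumNat.

Section AdaptedBasis.
Variables (F : fieldType) (k n' : nat) (e : 'I_k -> bool) (g : F).
Hypothesis g0 : g != 0.
Local Notation n := n'.+1.
Local Notation N := (tens F k n).
Implicit Types (u v w : word k n) (x y : N).

(** Coordinate form of both kinds of relation space, justified by [memWf]: [g] is [q] for images and
    [-1] for kernels, and [e] marks the letters allowed to repeat at positions [i], [i.+1]. *)
Definition inW (i : nat) x := forall w,
  ((letter w i < letter w i.+1)%N -> x w = - g * x (sw i w)) /\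
  (letter w i = letter w i.+1 -> ~~ e (letter w i) -> x w = 0).

Lemma inW_lin i a x y : inW i x -> inW i y -> inW i (a *: x + y).
Proof.
move=> Wx Wy w; have [x1 x2] := Wx w; have [y1 y2] := Wy w; rewrite !ffunE; split.
  by move=> lt; rewrite (x1 lt) (y1 lt) /GRing.scale /=; ring.
by move=> eq ne; rewrite x2 // y2 // scaler0 addr0.
Qed.

Lemma inW0 i : inW i 0.
Proof. by move=> w; rewrite !ffunE mulr0. Qed.

Definition desc w (i : nat) : bool :=
  (letter w i.+1 < letter w i)%N || (letter w i == letter w i.+1) && e (letter w i).

(** Index of the run of descents of [w] that contains position [j]. Then [code] orders pairs of a
    run and a letter lexicographically, with letters reversed, so that inside a run increasing codes
    mean decreasing letters. *)
Definition blk w (j : nat) : nat := (\sum_(i < j) ~~ desc w i)%N.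
Definition code w u (j : nat) : nat := (blk w j * k + (k - (letter u j).+1))%N.

(* [u] arises from [w] by permuting letters inside the maximal runs of descents of [w]. *)
Definition blkrel w u : bool := perm_eq (mkseq (code w u) n) (mkseq (code w w) n).

Lemma blkS w j : blk w j.+1 = (blk w j + ~~ desc w j)%N.
Proof. by rewrite /blk big_ord_recr. Qed.

Lemma blk_homo w a b : (a <= b)%N -> (blk w a <= blk w b)%N.
Proof.
elim: b => [|b IH] ab; first by have -> : a = 0%N by lia.
by case: (ltngtP a b.+1) ab => // [ab _|-> _ //]; rewrite blkS; have := IH ab; lia.
Qed.

Lemma code_inj (b1 b2 : nat) (a1 a2 : 'I_k) :
  (b1 * k + (k - a1.+1) = b2 * k + (k - a2.+1))%N -> b1 = b2 /\ a1 = a2.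
Proof.
have l1 := ltn_ord a1; have l2 := ltn_ord a2.
case: (ltngtP b1 b2) => [lt|lt|->] E.
- have := leq_mul2r k b1.+1 b2; rewrite lt orbT mulSn; lia.
- have := leq_mul2r k b2.+1 b1; rewrite lt orbT mulSn; lia.
- by split=> //; apply: val_inj => /=; lia.
Qed.

Lemma blkrel_refl w : blkrel w w. Proof. exact: perm_refl. Qed.

Lemma blkrel_sw w u i : (i.+1 < n)%N -> desc w i -> blkrel w (sw i u) = blkrel w u.
Proof.
move=> h d; apply: permPl; have := perm_mkseq_swn (code w u) h.
congr (perm_eq _ _); apply/eq_in_map => j; rewrite mem_iota => /andP [_ jn] /=.
rewrite /code letter_sw //; congr (_ * k + _)%N.
rewrite /swn; case: eqP => [->|_]; first by rewrite blkS d addn0.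
by case: eqP => [->|//]; rewrite blkS d addn0.
Qed.

Lemma desc_run w a b : (a <= b)%N -> (forall l, (a <= l < b)%N -> desc w l) ->
  (letter w b <= letter w a)%N.
Proof.
elim: b => [|b IH] ab H; first by have -> : a = 0%N by lia.
case: (ltngtP a b.+1) ab => // [ab _|-> _ //].
have h1 : (letter w b <= letter w a)%N by apply: IH => // l hl; apply: H; lia.
apply: leq_trans h1; have : desc w b by apply: H; lia.
by case/orP => [/ltnW //|/andP [/eqP -> _]].
Qed.

(** A letter repeated inside a run of [u] is repeated inside the same run of [w]. The letters of [w]
    decrease weakly along a run, so the repetition occurs at adjacent positions, where being a
    descent means that [e] holds. *)
Lemma blkrel_repeat w u i : blkrel w u -> (i.+1 < n)%N -> desc w i ->
  letter u i = letter u i.+1 -> e (letter u i).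
Proof.
move=> r h d eq.
have [s [sn se sinj]] := perm_mkseqP r.
have hi : (i < n)%N by lia.
have c1 : code w u i.+1 = code w u i by rewrite /code -eq blkS d addn0.
have [a [b [ab bn ea eb]]] : exists a b, [/\ (a < b)%N, (b < n)%N,
    code w w a = code w u i & code w w b = code w u i].
  case: (ltngtP (s i) (s i.+1)) => [lt|lt|/sinj eqs].
  - by exists (s i), (s i.+1); split; rewrite -?se //; exact: sn.
  - by exists (s i.+1), (s i); split; rewrite -?se //; exact: sn.
  - by have := eqs hi h; lia.
have [_ la] := code_inj ea.
have := ea; rewrite -eb => /code_inj [bab lab].
have D l : (a <= l < b)%N -> desc w l.
  move=> /andP [al lb]; have := blk_homo w al; have := blk_homo w lb.
  by rewrite -bab blkS; case: (desc w l) => //=; lia.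
have H : (letter w b <= letter w a.+1)%N by apply: desc_run => // l hl; apply: D; lia.
have /orP [lt|/andP [_]] : desc w a by apply: D; lia.
  by move: H; rewrite -lab leqNgt lt.
by rewrite la.
Qed.

Lemma code_sorted w u : (forall i, (i.+1 < n)%N -> desc w i -> (letter u i.+1 <= letter u i)%N) ->
  forall i, (i.+1 < n)%N -> (code w u i <= code w u i.+1)%N.
Proof.
move=> H i h; rewrite /code blkS; have := H i h; have := ltn_ord (letter u i).
case: (desc w i) => /= l; first by rewrite addn0 => /(_ isT); lia.
by rewrite addn1 mulSn => _; lia.
Qed.

(** [w] decreases weakly on its runs, so it has the most inversions in its class: any other member
    has an ascent inside a run, and swapping there adds an inversion. *)
Lemma blkrel_top w u : blkrel w u -> u = w \/ (ninv u < ninv w)%N.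
Proof.
have [m] := ubnP (n * n - ninv u)%N; elim: m u => // m IH u lu r.
case: (pickP (fun i : 'I_n => [&& (i.+1 < n)%N, desc w i & (letter u i < letter u i.+1)%N])).
  move=> i /and3P [h d lt]; right.
  have E := ninv_sw h lt; have le := ninv_le (sw i u).
  have r' : blkrel w (sw i u) by rewrite blkrel_sw.
  case: (IH _ _ r') => [|<-|]; rewrite E in le *; move: (n * n)%N lu le => Q; lia.
move=> H; left; apply: letterP => j jn.
have E : code w u j = code w w j.
  apply: (sorted_mkseq_inj r) => //; apply: code_sorted => i h d.
    by have /negbT := H (Ordinal (ltnW h)); rewrite /= h d /= -leqNgt.
  by case/orP: d => [/ltnW //|/andP [/eqP -> _]].
by case: (code_inj E).
Qed.

Definition dl : F := (- g)^-1.

Lemma dl0 : dl != 0. Proof. by rewrite invr_eq0 oppr_eq0. Qed.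

(** The factor [dl] per inversion is the one that [inW] forces at an ascent. *)
Definition bw w : N := [ffun u => if blkrel w u then dl ^+ ninv u else 0].

Lemma bw_inW w i : (i.+1 < n)%N -> desc w i -> inW i (bw w).
Proof.
move=> h d u; rewrite !ffunE blkrel_sw //; split.
  move=> lt; case: ifP => _; last by rewrite mulr0.
  by rewrite ninv_sw // exprS mulrA mulfV ?mul1r // oppr_eq0.
by move=> eq ne; case: ifP => // /blkrel_repeat/(_ h d eq); rewrite (negbTE ne).
Qed.

Definition Bm : 'End(N) := ffun_lin bw.

Lemma BmE x u : Bm x u = \sum_w x w * bw w u.
Proof. by rewrite /Bm ffun_linE sum_ffunE; apply: eq_bigr => w _; rewrite ffunE. Qed.

(** Triangularity: by [blkrel_top], the only word in the support of [bw w] with at least [ninv w]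
    inversions is [w] itself. *)
Lemma Bm_top x u : (forall w, (ninv u < ninv w)%N -> x w = 0) ->
  Bm x u = x u * dl ^+ ninv u.
Proof.
move=> H; rewrite BmE (bigD1 u) //= big1 => [|w wu].
  by rewrite addr0 ffunE blkrel_refl.
rewrite ffunE; case: ifP => [r|_]; last by rewrite mulr0.
case: (blkrel_top r) => [uw|/H ->]; last by rewrite mul0r.
by rewrite uw eqxx in wu.
Qed.

Lemma Bm_inj : lker Bm = 0%VS.
Proof.
apply/eqP; rewrite -subv0; apply/subvP => x; rewrite memv_ker => /eqP Bx; rewrite memv0.
have H m w : (n * n - ninv w < m)%N -> x w = 0.
  elim: m w => // m IH w lw; have := Bm_top (u := w) (x := x); rewrite Bx ffunE => E.
  have /esym/eqP : 0 = x w * dl ^+ ninv w.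
    by apply: E => v lv; apply: IH; move: (ninv_le v) lw; move: (n * n)%N => Q; lia.
  by rewrite mulf_eq0 expf_eq0 (negbTE dl0) andbF orbF => /eqP.
by apply/eqP/ffunP => w; rewrite ffunE; apply: (H (n * n - ninv w).+1).
Qed.

Lemma inW_Bm i (c : N) : (i.+1 < n)%N -> (forall v, c v != 0 -> desc v i) -> inW i (Bm c).
Proof.
move=> h H; rewrite /Bm ffun_linE; elim/big_ind: _ => [|y z Wy Wz|v _].
- exact: inW0.
- by have := inW_lin 1 Wy Wz; rewrite scale1r.
have [->|/H d] := eqVneq (c v) 0; first by rewrite scale0r; exact: inW0.
by rewrite -[_ *: _]addr0; apply: inW_lin; [exact: bw_inW|exact: inW0].
Qed.

(** Elimination of leading terms, by induction on a strict bound [m] for the inversions in the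
    support. An ascent at [i] in a top word would force its swap, with one more inversion, into the
    support, and a forbidden repetition has coefficient zero. So top words have a descent at [i],
    and subtracting multiples of their [bw] lowers the bound. *)
Lemma inW_expand i x : (i.+1 < n)%N -> inW i x ->
  exists2 c : N, x = Bm c & forall v, c v != 0 -> desc v i.
Proof.
move=> h; have: forall u, ((n * n).+1 <= ninv u)%N -> x u = 0.
  by move=> u; rewrite ltnNge ninv_le.
move: (n * n).+1 => m; elim: m x => [|m IH] x H Wx.
  exists 0 => [|v]; last by rewrite ffunE eqxx.
  by rewrite linear0; apply/ffunP => u; rewrite H ?ffunE.
pose c0 : N := [ffun w => if ninv w == m then x w / dl ^+ m else 0].
have c0d v : c0 v != 0 -> desc v i.
  rewrite ffunE; case: (ninv v =P m) => [em|_]; last by rewrite eqxx.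
  have [W1 W2] := Wx v; move=> nz; apply: contraNT nz.
  rewrite negb_or negb_and -leqNgt leq_eqVlt => /andP [/orP [/eqP/val_inj eq|lt]].
    by rewrite eq eqxx /= -eq => ne; rewrite W2 // mul0r.
  by rewrite W1 // H ?mulr0 ?mul0r // ninv_sw // em.
have [] := IH (x - Bm c0).
- move=> u lu; rewrite !ffunE Bm_top; last first.
    by move=> w lw; rewrite ffunE; case: eqP => // ew; lia.
  rewrite ffunE; case: eqP => [->|ne].
    by rewrite mulfVK ?subrr // expf_eq0 (negbTE dl0) andbF.
  by rewrite mul0r subr0 H //; lia.
- by rewrite addrC -scaleN1r; apply: inW_lin => //; exact: inW_Bm.
move=> c1 E c1d; exists (c0 + c1); first by rewrite linearD /= -E addrC subrK.
move=> v; rewrite ffunE; have [->|/c0d //] := eqVneq (c0 v) 0.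
by rewrite add0r; exact: c1d.
Qed.

(** Coordinates with respect to the basis [bw]. *)
Definition kap : 'End(N) := (Bm^-1)%VF.

Lemma kapK x : kap (Bm x) = x.
Proof. by apply: lker0_lfunK; rewrite Bm_inj. Qed.

Lemma BmK x : Bm (kap x) = x.
Proof. by apply: lker0_lfunVK; rewrite Bm_inj. Qed.

Lemma kap_inW i x v : (i.+1 < n)%N -> inW i x -> ~~ desc v i -> kap x v = 0.
Proof.
move=> h /(inW_expand h) [c -> H]; rewrite kapK => nd.
by apply/eqP; apply: contraNT nd => /H.
Qed.

End AdaptedBasis.

(* [true] selects the relations of S(V,R), [false] those of Lambda(V,R). *)
Definition Wf (F : fieldType) (q : F) (b : bool) (M : vectType F) (t : nat -> 'End(M))
    (i : nat) : {vspace M} :=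
  if b then limg (t i - q *: \1%VF) else lker (t i - q *: \1%VF).

Lemma Wf_equivariant (F : fieldType) (q : F) b n (M N : vectType F)
    (t : nat -> 'End(M)) (s : nat -> 'End(N)) (f : 'Hom(M, N)) i x :
  equivariant n t s f -> (i.+1 < n)%N -> x \in Wf q b t i -> f x \in Wf q b s i.
Proof.
move=> ef h; case: b => /=.
  move=> /memv_imgP [y _ ->]; apply/memv_imgP; exists (f y); rewrite ?memvf //.
  by rewrite !(add_lfunE, opp_lfunE, scale_lfunE, id_lfunE) linearB linearZ /= ef.
rewrite !memv_ker !(add_lfunE, opp_lfunE, scale_lfunE, id_lfunE) -ef // -linearZ -linearB /=.
by move/eqP ->; rewrite linear0.
Qed.

(** * The spaces Im (T_i - q) and Ker (T_i - q) on a word module *)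

Section WordW.
Variables (F : fieldType) (q : F) (k n' : nat) (c : 'I_k -> F).
Hypothesis q0 : q != 0.
Hypothesis hc : forall a, (c a - q) * (c a + 1) = 0.
Local Notation n := n'.+1.
Local Notation N := (tens F k n).
Local Notation wT := (@wT F q k n' c).
Implicit Types (u v w : word k n) (x y : N).

Definition eps (b : bool) (a : 'I_k) : bool := if b then c a != q else c a == q.
Definition gam (b : bool) : F := if b then q else -1.

Lemma gam0 b : gam b != 0.
Proof. by case: b; rewrite //= oppr_eq0 oner_eq0. Qed.

Lemma wTqE i x w : (wT i - q *: \1%VF) x w =
  if (letter w i < letter w i.+1)%N then q * (x (sw i w) - x w)
  else if (letter w i.+1 < letter w i)%N then x (sw i w) - x w
  else (c (letter w i) - q) * x w.
Proof.
rewrite add_lfunE opp_lfunE scale_lfunE id_lfunE !ffunE wTE /pcf /qcf /GRing.scale /=.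
by case: ltngtP => _; ring.
Qed.

Lemma memWf b i x : (i.+1 < n)%N -> x \in Wf q b wT i <-> inW (eps b) (gam b) i x.
Proof.
move=> h; case: b => /=; split.
- move=> /memv_imgP [y _ ->] w; rewrite !wTqE letter_swl // letter_swr // swK //; split.
    by case: ltngtP => // _ _; ring.
  by move=> ->; rewrite ltnn negbK => /eqP ->; rewrite subrr mul0r.
(* A preimage chosen to vanish on words with a strict descent at [i], so that each swapped pair has
   one unknown. The division is by zero only where [x] vanishes anyway. *)
- move=> H; apply/memv_imgP; pose y : N := [ffun w =>
    if (letter w i < letter w i.+1)%N then x (sw i w)
    else if (letter w i.+1 < letter w i)%N then 0 else x w / (c (letter w i) - q)].
  exists y; rewrite ?memvf //; apply/ffunP => w; rewrite wTqE /y !ffunE.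
  rewrite letter_swl // letter_swr // swK //.
  case: ltngtP => [lt|lt|/val_inj eq]; rewrite ?subr0 //.
  + by have [-> //] := H w; rewrite sub0r mulrN mulNr.
  + have [_ H2] := H w; have [e|ne] := eqVneq (c (letter w i)) q.
      by rewrite H2 ?mul0r ?mulr0 // /eps e eqxx.
    by rewrite mulrC mulfVK // subr_eq0.
- rewrite memv_ker => /eqP/ffunP H w; have := H w; rewrite wTqE ffunE => E; split.
    move=> lt; move: E; rewrite lt => /eqP; rewrite mulf_eq0 (negbTE q0) subr_eq0 /=.
    by move/eqP ->; rewrite opprK mul1r.
  rewrite /eps /= => eq ne; move: E; rewrite eq ltnn => /eqP; rewrite -eq mulf_eq0 subr_eq0.
  by rewrite (negbTE ne) => /eqP.
- move=> H; rewrite memv_ker; apply/eqP/ffunP => w; rewrite wTqE ffunE.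
  case: ltngtP => [lt|lt|/val_inj eq].
  + by have [-> //] := H w; rewrite opprK mul1r subrr mulr0.
  + have [/(_ _)] := H (sw i w); rewrite letter_swl // letter_swr // swK // => -> //.
    by rewrite opprK mul1r subrr.
  + have [_ H2] := H w; have [e|ne] := eqVneq (c (letter w i)) q.
      by rewrite e subrr mul0r.
    by rewrite H2 ?mulr0.
Qed.

(** The coordinates of [x] in the basis [bw] are supported on words with descents at all [i < p] and
    at some [j >= p]. Splitting them by whether [p] is a descent gives [y] and [z]; for [z] the
    descent found lies beyond [p]. *)
Lemma word_distr b p x : (p.+1 < n)%N ->
  (forall i, (i < p)%N -> x \in Wf q b wT i) ->
  x \in (\sum_(p <= j < n') Wf q b wT j)%VS ->
  exists y z, [/\ x = y + z, forall i, (i < p.+1)%N -> y \in Wf q b wT i,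
    forall i, (i < p)%N -> z \in Wf q b wT i &
    z \in (\sum_(p.+1 <= j < n') Wf q b wT j)%VS].
Proof.
move=> hp Wx Sx.
pose e := eps b; have g0 := gam0 b.
pose K := kap n' e (gam b); pose B := Bm n' e (gam b).
have KW i v : (i < p)%N -> ~~ desc e v i -> K x v = 0.
  by move=> ip; apply: (kap_inW g0); [lia|apply/memWf; [lia|exact: Wx]].
have KS v : (forall j, (p <= j < n')%N -> ~~ desc e v j) -> K x v = 0.
  move=> nd; move: x Sx {Wx KW}; apply: sumv_nat_ind.
  - by rewrite linear0 ffunE.
  - by move=> y z Ky Kz; rewrite linearD ffunE Ky Kz addr0.
  move=> j pj y Wy; apply: (kap_inW g0 (i := j)); [lia| |exact: nd].
  by apply/memWf => //; lia.
have BW (f : N) i : (i.+1 < n)%N -> (forall v, f v != 0 -> desc e v i) -> B f \in Wf q b wT i.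
  by move=> hi H; apply/memWf => //; exact: (inW_Bm g0).
pose f1 : N := [ffun v => if desc e v p then K x v else 0].
pose f2 : N := [ffun v => if desc e v p then 0 else K x v].
have f1d i v : (i < p.+1)%N -> f1 v != 0 -> desc e v i.
  rewrite ffunE; case: ifP => [d|_]; last by rewrite eqxx.
  rewrite ltnS leq_eqVlt => /orP [/eqP -> //|ip]; apply: contraNT => nd.
  by rewrite (KW i).
have f2d i v : (i < p)%N -> f2 v != 0 -> desc e v i.
  rewrite ffunE; case: ifP => [_|_]; first by rewrite eqxx.
  by move=> ip; apply: contraNT => nd; rewrite (KW i).
exists (B f1), (B f2); split.
- rewrite -linearD /= -[LHS](BmK e g0); congr (B _); apply/ffunP => v; rewrite !ffunE.
  by case: ifP; rewrite ?addr0 ?add0r.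
- by move=> i ip; apply: BW => [|v]; [lia|exact: f1d].
- by move=> i ip; apply: BW => [|v]; [lia|exact: f2d].
rewrite /B /Bm ffun_linE; apply: memv_suml => v _.
have [->|nz] := eqVneq (f2 v) 0; first by rewrite scale0r mem0v.
apply: memvZ; move: nz; rewrite ffunE; case: ifP => [|ndp nz]; first by rewrite eqxx.
case: (pickP (fun j : 'I_n' => (p <= j)%N && desc e v j)) => [j /andP [pj dj]|H]; last first.
  case/eqP: nz; apply: KS => j /andP [pj jn].
  by have := H (Ordinal jn); rewrite /= pj /= => ->.
have pj' : (p.+1 <= j < n')%N.
  by case: (ltngtP p j) pj dj => // [? _ _|<-]; [rewrite ltn_ord|rewrite ndp].
apply: (memv_sum_nat pj'); apply/memWf; first by lia.
by apply: bw_inW => //; lia.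
Qed.

End WordW.

(** * Induced modules as retracts of word modules *)

Lemma comp_equivariant (F : fieldType) n (L M N : vectType F) (r : nat -> 'End(L))
    (t : nat -> 'End(M)) (s : nat -> 'End(N)) (f : 'Hom(L, M)) (g : 'Hom(M, N)) :
  equivariant n r t f -> equivariant n t s g -> equivariant n r s (g \o f)%VF.
Proof. by move=> ef eg i h x; rewrite !comp_lfunE ef ?eg. Qed.

Section Content.
Variables (F : fieldType) (q : F) (k n' : nat) (c : 'I_k -> F).
Local Notation n := n'.+1.
Local Notation N := (tens F k n).

Definition prc (v : word k n) : 'End(N) :=
  linfun (fun x : N => [ffun w => if csame w v then x w else 0] : N).

Lemma prcE v x w : prc v x w = if csame w v then x w else 0.
Proof.
rewrite /prc linfun_linE ?ffunE // => a y z; apply/ffunP => u; rewrite !ffunE.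
by case: ifP => _ //; rewrite scaler0 addr0.
Qed.

Lemma prc_equivariant v : equivariant n (wT q n' c) (wT q n' c) (prc v).
Proof.
move=> i h x; apply/ffunP => w; rewrite wTE !prcE wTE csame_sw //.
by case: ifP => // _; rewrite !mulr0 addr0.
Qed.

Lemma prc_ev v : prc v (ev F v) = ev F v.
Proof.
apply/ffunP => w; rewrite prcE ffunE; case: eqP => [->|_]; last by case: ifP.
by rewrite csame_refl.
Qed.
End Content.

Section BlockWord.
Variables (n' : nat) (la : seq nat).
Local Notation n := n'.+1.

Definition bpos (j : nat) : nat := (\sum_(i < j) ~~ parab n la i)%N.

Lemma bposS j : bpos j.+1 = (bpos j + ~~ parab n la j)%N.
Proof. by rewrite /bpos big_ord_recr. Qed.

Lemma bpos_le j : (bpos j <= j)%N.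
Proof. by elim: j => [|j IH]; rewrite ?bposS /bpos ?big_ord0 //; have := IH; rewrite /bpos; lia. Qed.

Lemma bpos_homo a b : (a <= b)%N -> (bpos a <= bpos b)%N.
Proof.
elim: b => [|b IH] ab; first by have -> : a = 0%N by lia.
by case: (ltngtP a b.+1) ab => // [ab _|-> _ //]; rewrite bposS; have := IH ab; lia.
Qed.

(** The sorted word that is constant on the blocks of [la], with a new letter for each block, so
    that its stabilizer is the parabolic subgroup. *)
Definition bword : word n n := [ffun j : 'I_n => inord (bpos j)].

Lemma letter_bword j : (j < n)%N -> letter bword j = bpos j :> nat.
Proof.
by move=> jn; rewrite /letter ffunE inordK // inordK //; apply: leq_ltn_trans (bpos_le j) _.
Qed.

Lemma bword_sorted : wsorted bword.
Proof. by move=> i h; rewrite !letter_bword ?bpos_homo // ltnW. Qed.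

Lemma bword_same i : (i.+1 < n)%N -> (letter bword i == letter bword i.+1) = parab n la i.
Proof.
move=> h; rewrite -val_eqE /= !letter_bword ?(ltnW h) // bposS.
by case: (parab n la i); rewrite /= ?addn0 ?eqxx // addn1 eqn_leq ltnn andbF.
Qed.

End BlockWord.

Section InducedRetract.
Variables (F : fieldType) (q : F) (n' : nat) (la : seq nat) (chi : nat -> F).
Local Notation n := n'.+1.
Hypothesis q0 : q != 0.
Hypothesis H1 : onedim_rep n q la chi.

(** The value of [chi] on the block with letter [a]. A letter without parabolic index, such as that
    of a block of size one, gets [q], a root of the quadratic relation. *)
Definition bchar (a : 'I_n) : F :=
  if [pick j : 'I_n | parab n la j && (letter (bword n' la) j == a)] is Some j then chi j else q.

Lemma bchar_quad a : (bchar a - q) * (bchar a + 1) = 0.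
Proof.
rewrite /bchar; case: pickP => [j /andP [pj _]|_]; last by rewrite subrr mul0r.
by case: H1 => H _; apply: H.
Qed.

Lemma chi_neq0 j : parab n la j -> chi j != 0.
Proof.
case: H1 => H _ /H /eqP; rewrite mulf_eq0 subr_eq0 addr_eq0 => /orP [/eqP -> //|/eqP ->].
by rewrite oppr_eq0 oner_eq0.
Qed.

(** For neighbouring generators the braid relation reads [x y x = y x y] between nonzero scalars and
    forces [x = y], so [chi] is constant on a block. *)
Lemma chi_run a b : (a <= b)%N -> parab n la b -> bpos n' la a = bpos n' la b -> chi a = chi b.
Proof.
elim: b => [|b IH] ab pb e; first by have -> : a = 0%N by lia.
case: (ltngtP a b.+1) ab => // [ab _|-> //].
have := bpos_homo n' la (ab : (a <= b)%N); have := bposS n' la b.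
case pb' : (parab n la b) => /= E1 E2; last by lia.
rewrite IH //; last by lia.
case: H1 => _ /(_ _ pb' pb) E.
have n1 := chi_neq0 pb'; have n2 := chi_neq0 pb.
apply: (mulIf (mulf_neq0 n1 n2)).
by rewrite [chi b * (_ * _)]mulrC E; ring.
Qed.

Lemma bchar_parab i : (i.+1 < n)%N -> parab n la i -> bchar (letter (bword n' la) i) = chi i.
Proof.
move=> h pi; rewrite /bchar; case: pickP => [j /andP [pj /eqP e]|H]; last first.
  by have := H (Ordinal (ltnW h)); rewrite /= pi eqxx.
have {}e : bpos n' la j = bpos n' la i by rewrite -!letter_bword ?e // ltnW.
case: (leqP j i) => [ji|/ltnW ij]; first exact: chi_run.
by apply/esym/chi_run.
Qed.

(** The universal property of [M] sends [m] to the basis vector of [bword]; [wpsi] sends it back to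
    [m] and the other sorted words to zero. The composite is equivariant and fixes [m], hence is the
    identity by uniqueness. The projection [prc] in between confines the image to one weight
    component. *)
Lemma induced_retract (M : vectType F) (t : nat -> 'End(M)) (m : M) :
  induced n q la chi t m ->
  exists (phi : 'Hom(M, tens F n n)) (psi : 'Hom(tens F n n, M)),
    [/\ equivariant n t (wT q n' bchar) phi, equivariant n (wT q n' bchar) t psi,
        forall x, psi (phi x) = x & forall x, prc F (bword n' la) (phi x) = phi x].
Proof.
move=> [tH [tm U]].
have [] := U _ (wT q n' bchar) (ev F (bword n' la)) (wT_hmod n' bchar_quad).
  move=> j pj; have h : (j.+1 < n)%N by case/andP: pj.
  rewrite wT_ev //; have := bword_same la h; rewrite pj => /eqP e.
  by rewrite -e ltnn bchar_parab.
move=> phi [[ephi phim] _].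
pose base (w : word n n) := if w == (bword n' la) then m else 0.
have base_eq w : wsorted w -> forall i, (i.+1 < n)%N ->
    letter w i = letter w i.+1 -> t i (base w) = bchar (letter w i) *: base w.
  rewrite /base; case: eqP => [-> _ i h e|_ _ i _ _]; last by rewrite linear0 scaler0.
  have pi : parab n la i by rewrite -bword_same // e eqxx.
  by rewrite tm // bchar_parab.
pose psi := wpsi t base.
have epsi : equivariant n (wT q n' bchar) t psi := wpsi_equivariant tH base_eq.
exists (prc F (bword n' la) \o phi)%VF, psi; split=> //.
- exact: comp_equivariant ephi (@prc_equivariant F q n n' bchar (bword n' la)).
- have [f [_ fu]] := U M t m tH tm.
  have e1 := fu \1%VF; have e2 := fu (psi \o (prc F (bword n' la) \o phi))%VF.
  have : \1%VF = (psi \o (prc F (bword n' la) \o phi))%VF.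
    rewrite -e1 ?e2 //; last by split=> [i h x|]; rewrite !id_lfunE.
    split; last first.
      by rewrite !comp_lfunE phim prc_ev wpsi_sorted ?/base ?eqxx //; exact: bword_sorted.
    apply: comp_equivariant epsi.
    exact: comp_equivariant ephi (@prc_equivariant F q n n' bchar (bword n' la)).
  by move=> E x; rewrite -!comp_lfunE -E id_lfunE.
by move=> x; apply/ffunP => w; rewrite !comp_lfunE !prcE; case: (csame w _).
Qed.

End InducedRetract.

(** * Equivariant idempotents and Koszulness *)

Lemma daddv_pi_submod (F : fieldType) (V : vectType F) (t : 'End(V)) (A B : {vspace V}) x :
  (A :&: B = 0)%VS ->
  (t @: A <= A)%VS -> (t @: B <= B)%VS -> x \in (A + B)%VS ->
  daddv_pi A B (t x) = t (daddv_pi A B x).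
Proof.
move=> AB0 sA sB /memv_addP [a aA [b bB ->]].
have ta : t a \in A by apply: (subvP sA); exact: memv_img.
have tb : t b \in B by apply: (subvP sB); exact: memv_img.
have piB y : y \in B -> daddv_pi A B y = 0.
  move=> yB; have := daddv_pi_add AB0 (w := y).
  rewrite -[y in y \in _]add0r memv_add ?mem0v // => /(_ isT).
  rewrite [daddv_pi B A y]daddv_pi_id ?(capvC B) // => /eqP.
  by rewrite -subr_eq0 addrK => /eqP.
by rewrite !linearD /= (daddv_pi_id AB0 ta) (daddv_pi_id AB0 aA) !piB // linear0.
Qed.

Section Idempotents.
Variables (F : fieldType) (V : vectType F) (n : nat) (t : nat -> 'End(V)).

Definition eqidem (e : 'End(V)) := equivariant n t t e /\ forall x, e (e x) = e x.

Lemma limg_idem e x : eqidem e -> x \in limg e -> e x = x.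
Proof. by move=> [_ ee] /memv_imgP [y _ ->]. Qed.

Lemma eqidem_dsummand e : eqidem e -> dsummand n t (limg e).
Proof.
move=> [et ee]; split.
  move=> i h; apply/subvP => y /memv_imgP [x /memv_imgP [z _ ->] ->].
  by rewrite -et // memv_img // memvf.
have cap0 : (limg e :&: lker e)%VS = 0%VS.
  apply/eqP; rewrite -subv0; apply/subvP => x /memv_capP [xe].
  by rewrite memv_ker (limg_idem (conj et ee) xe) memv0.
exists (lker e); split; [|split].
- move=> i h; apply/subvP => y /memv_imgP [x]; rewrite memv_ker => /eqP ex ->.
  by rewrite memv_ker et // ex linear0.
- by apply/directv_addP.
- apply/eqP; rewrite eqEsubv subvf /=; apply/subvP => x _.
  have -> : x = e x + (x - e x) by rewrite addrC subrK.
  by rewrite memv_add // ?memv_img ?memvf // memv_ker linearB /= ee subrr.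
Qed.

(** The existence half of Krull-Schmidt as an induction principle: a decomposable image splits [e]
    into two orthogonal equivariant idempotents of smaller rank. Whether the image is decomposable
    is settled by excluded middle. *)
Lemma eqidem_ind (P : 'End(V) -> Prop) :
  P 0 ->
  (forall e1 e2, eqidem e1 -> eqidem e2 -> (forall x, e1 (e2 x) = 0) ->
     (forall x, e2 (e1 x) = 0) -> P e1 -> P e2 -> P (e1 + e2)) ->
  (forall e, eqidem e -> indecomposable n t (limg e) -> P e) ->
  forall e, eqidem e -> P e.
Proof.
move=> P0 PD PI e; have [m] := ubnP (\dim (limg e)); elim: m e => // m IH e le ide.
have [e0|ne0] := eqVneq (limg e) 0%VS.
  suff -> : e = 0 by [].
  apply/lfunP => x; rewrite zero_lfunE; apply/eqP; rewrite -memv0 -e0.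
  by rewrite memv_img // memvf.
have [/PI|nind] := classic (indecomposable n t (limg e)); first exact.
have [A [B [sA [sB [dAB [AB [nA nB]]]]]]] : exists A B, submod n t A /\ submod n t B /\
    directv (A + B) /\ (A + B)%VS = limg e /\ A <> 0%VS /\ B <> 0%VS.
  apply: NNPP => H; apply: nind; split=> // A B sA sB dAB AB; apply: NNPP => H'.
  by apply: H; exists A, B; do 4?split=> //; split=> E; apply: H'; [left|right].
have AB0 : (A :&: B = 0)%VS by apply/directv_addP.
have BA0 : (B :&: A = 0)%VS by rewrite capvC.
have [et ee] := ide.
have eAB x : e x \in (A + B)%VS by rewrite AB memv_img // memvf.
pose eA := (daddv_pi A B \o e)%VF; pose eB := (daddv_pi B A \o e)%VF.
have eA_A a : a \in A -> eA a = a.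
  move=> aA; rewrite comp_lfunE (limg_idem ide) ?daddv_pi_id //.
  by rewrite -AB -[a]addr0 memv_add ?mem0v.
have eB_B a : a \in B -> eB a = a.
  move=> aB; rewrite comp_lfunE (limg_idem ide) ?daddv_pi_id //.
  by rewrite -AB -[a]add0r memv_add ?mem0v.
have sum x : eA x + eB x = e x by rewrite !comp_lfunE daddv_pi_add.
have eAm x : eA x \in A by rewrite comp_lfunE memv_pi.
have eBm x : eB x \in B by rewrite comp_lfunE memv_pi.
have inA a : a \in A -> e a = a.
  by move=> aA; apply: (limg_idem ide); rewrite -AB -[a]addr0 memv_add ?mem0v.
have inB a : a \in B -> e a = a.
  by move=> aB; apply: (limg_idem ide); rewrite -AB -[a]add0r memv_add ?mem0v.
have eBA x : eB (eA x) = 0.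
  by have := sum (eA x); rewrite (eA_A _ (eAm x)) (inA _ (eAm x)) => /eqP;
    rewrite -subr_eq0 [eA x + _]addrC addrK => /eqP.
have eAB0 x : eA (eB x) = 0.
  by have := sum (eB x); rewrite (eB_B _ (eBm x)) (inB _ (eBm x)) => /eqP; rewrite -subr_eq0 addrK => /eqP.
have ideA : eqidem eA.
  split=> [i h x|x]; last by rewrite eA_A.
  by rewrite !comp_lfunE et // daddv_pi_submod //; [exact: sA|exact: sB].
have ideB : eqidem eB.
  split=> [i h x|x]; last by rewrite eB_B.
  by rewrite !comp_lfunE et // daddv_pi_submod //; [exact: sB|exact: sA|rewrite addvC].
have -> : e = eA + eB by apply/lfunP => x; rewrite add_lfunE sum.
have dimAB : (\dim A + \dim B)%N = \dim (limg e) by rewrite -AB dimv_disjoint_sum.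
have dA : (0 < \dim A)%N by rewrite lt0n dimv_eq0; apply/eqP.
have dB : (0 < \dim B)%N by rewrite lt0n dimv_eq0; apply/eqP.
have lA : (\dim (limg eA) <= \dim A)%N.
  by apply: dimvS; apply/subvP => y /memv_imgP [x _ ->].
have lB : (\dim (limg eB) <= \dim B)%N.
  by apply: dimvS; apply/subvP => y /memv_imgP [x _ ->].
by apply: PD => //; apply: IH => //; lia.
Qed.

Lemma iso_factor (M : vectType F) (s : nat -> 'End(M)) e : eqidem e ->
  iso_to_summand n t s (limg e) ->
  exists (phi : 'Hom(V, M)) (psi : 'Hom(M, V)),
    [/\ equivariant n t s phi, equivariant n s t psi, forall x, psi (phi x) = e x,
        forall x, phi (e x) = phi x & forall y, e (psi y) = psi y].
Proof.
move=> ide [A [B [sA [sB [dAB [AB [f [ef [fA fk]]]]]]]]].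
have [et ee] := ide.
have AB0 : (A :&: B = 0)%VS by apply/directv_addP.
have eU x : e x \in limg e by rewrite memv_img // memvf.
pose h := (f \o e)%VF.
have hA : limg h = A by rewrite limg_comp.
have finj x y : x \in limg e -> y \in limg e -> f x = f y -> x = y.
  move=> xU yU fxy; apply/eqP; rewrite -subr_eq0 -memv0 -fk memv_cap (memvB xU yU) andbT.
  by rewrite memv_ker linearB /= fxy subrr.
have efU i x : (i.+1 < n)%N -> x \in limg e -> t i x \in limg e.
  by move=> hi xU; rewrite -(limg_idem ide xU) -et.
(* [h^-1] is only a linear one-sided inverse. Composing with [e] lands in [limg e], where [f] is
   injective, so equivariance can be checked after applying [f]. *)
pose psi := (e \o h^-1 \o daddv_pi A B)%VF.
have fpsi y : f (psi y) = daddv_pi A B y.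
  rewrite /psi !comp_lfunE -[f (e _)]comp_lfunE -/h limg_lfunVK //.
  by rewrite hA memv_pi.
have psiU y : psi y \in limg e by rewrite /psi !comp_lfunE.
have hm x : h x \in A by rewrite -hA memv_img // memvf.
exists h, psi; split.
- by move=> i hi x; rewrite !comp_lfunE et // ef.
- move=> i hi y; apply: finj => //; first exact: efU.
  rewrite fpsi ef // fpsi daddv_pi_submod //; [exact: sA|exact: sB|].
  by rewrite AB memvf.
- move=> x; apply: finj => //; rewrite fpsi daddv_pi_id //.
  by rewrite comp_lfunE.
- by move=> x; rewrite !comp_lfunE ee.
- by move=> y; rewrite (limg_idem ide).
Qed.
End Idempotents.

(** * Passage from tensor powers of V to word modules *)

Section Source.
Variables (F : fieldType) (d : nat) (q : F) (R : 'End(tens F d 2)).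
Hypothesis q0 : q != 0.
Hypothesis src : onedim_source q R.
Variable n' : nat.
Local Notation n := n'.+1.
Local Notation V := (tens F d n).
Local Notation T := (Tfam n R).

Lemma source_factor e : eqidem n T e -> indecomposable n T (limg e) ->
  exists (c : 'I_n -> F) (v : word n n) (phi : 'Hom(V, tens F n n)) (psi : 'Hom(tens F n n, V)),
    [/\ forall a, (c a - q) * (c a + 1) = 0, wsorted v,
        equivariant n T (wT q n' c) phi /\ equivariant n (wT q n' c) T psi,
        [/\ forall x, psi (phi x) = e x, forall x, phi (e x) = phi x &
            forall y, e (psi y) = psi y]
      & forall x, prc F v (phi x) = phi x].
Proof.
move=> ide ind.
have [la [chi [_ [H1 [M [t [m [indM iso]]]]]]]] := src (ltn0Sn _) (eqidem_dsummand ide) ind.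
have [phi0 [psi0 [e1 e2 p1 p2 p3]]] := iso_factor ide iso.
have [phi1 [psi1 [e3 e4 r1 r2]]] := induced_retract q0 H1 indM.
exists (bchar q la chi), (bword n' la), (phi1 \o phi0)%VF, (psi0 \o psi1)%VF; split.
- exact: bchar_quad H1.
- exact: bword_sorted.
- by split; [exact: comp_equivariant e1 e3|exact: comp_equivariant e4 e2].
- by split=> x; rewrite !comp_lfunE ?r1 ?p1 ?p2 ?p3.
- by move=> x; rewrite comp_lfunE r2.
Qed.

Lemma id_eqidem : eqidem n T \1%VF.
Proof. by split=> [i h x|x]; rewrite !id_lfunE. Qed.

(** The property that [e x] splits is additive in [e]; on an indecomposable image the splitting of
    [phi x] from [word_distr] is carried back by [psi]. The claim is the case of the identity. *)
Lemma source_distr b p x : (p.+1 < n)%N ->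
  (forall i, (i < p)%N -> x \in Wf q b T i) ->
  x \in (\sum_(p <= j < n') Wf q b T j)%VS ->
  exists y z, [/\ x = y + z, forall i, (i < p.+1)%N -> y \in Wf q b T i,
    forall i, (i < p)%N -> z \in Wf q b T i &
    z \in (\sum_(p.+1 <= j < n') Wf q b T j)%VS].
Proof.
move=> hp Wx Sx.
pose P (e : 'End(V)) := exists y z, [/\ e x = y + z, forall i, (i < p.+1)%N -> y \in Wf q b T i,
    forall i, (i < p)%N -> z \in Wf q b T i &
    z \in (\sum_(p.+1 <= j < n') Wf q b T j)%VS].
suff : P \1%VF by rewrite /P id_lfunE.
apply: (@eqidem_ind _ _ n T P) id_eqidem.
- by exists 0, 0; rewrite zero_lfunE addr0; split=> // *; rewrite mem0v.
- move=> e1 e2 _ _ _ _ [y1 [z1 [E1 Y1 Z1 S1]]] [y2 [z2 [E2 Y2 Z2 S2]]].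
  exists (y1 + y2), (z1 + z2); split.
  + by rewrite add_lfunE E1 E2 addrACA.
  + by move=> i h; rewrite memvD ?Y1 ?Y2.
  + by move=> i h; rewrite memvD ?Z1 ?Z2.
  + by rewrite memvD.
move=> e ide ind.
have [c [v [phi [psi [hc _ [ephi epsi] [pp _ _] _]]]]] := source_factor ide ind.
have [||y [z [E Y Z S]]] := @word_distr F q n n' c q0 b p (phi x) hp.
- by move=> i ip; apply: (Wf_equivariant ephi); [lia|exact: Wx].
- move: x Sx {Wx P}; apply: sumv_nat_ind.
  + by rewrite linear0 mem0v.
  + by move=> y z Hy Hz; rewrite linearD memvD.
  + by move=> j pj y Wy; apply: (memv_sum_nat pj); apply: (Wf_equivariant ephi) => //; lia.
exists (psi y), (psi z); split.
- by rewrite -pp E linearD.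
- by move=> i ip; apply: (Wf_equivariant epsi); [lia|exact: Y].
- by move=> i ip; apply: (Wf_equivariant epsi); [lia|exact: Z].
move: z S {E Z}; apply: sumv_nat_ind.
+ by rewrite linear0 mem0v.
+ by move=> z1 z2 H1 H2; rewrite linearD memvD.
+ by move=> j pj z Wz; apply: (memv_sum_nat pj); apply: (Wf_equivariant epsi) => //; lia.
Qed.

End Source.

(** * Koszulness of both quadratic algebras *)

Definition Xfam (F : fieldType) (d : nat) (q : F) (b : bool) (R : 'End(tens F d 2)) : qfam F d :=
  if b then Sfam q R else Lfam q R.

Lemma XfamE (F : fieldType) (d : nat) (q : F) b (R : 'End(tens F d 2)) m i :
  Xfam q b R m i = Wf q b (Tfam m R) i.
Proof. by case: b. Qed.

Lemma memv_bigcap_ord (F : fieldType) (V : vectType F) p (W : nat -> {vspace V}) x :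
  x \in (\bigcap_(i < p) W i)%VS <-> forall i, (i < p)%N -> x \in W i.
Proof.
split=> [H i ip|H].
  by move/subvP: (bigcapv_inf (Ordinal ip) (P := predT)
    (Us := fun i : 'I_p => W i) isT (subvv _)) => /(_ _ H).
by rewrite memvE; apply/subv_bigcapP => i _; rewrite -memvE; exact: H.
Qed.

(** In homological degree [p.+1] the cycles are the elements of all W_i with [i < p] that lie in the
    sum of the W_j with [j >= p], so exactness is the splitting of [source_distr]. *)
Lemma koszul_Xfam (F : fieldType) (d : nat) (q : F) b (R : 'End(tens F d 2)) :
  q != 0 -> onedim_source q R -> koszul (Xfam q b R).
Proof.
move=> q0 src [|n'] [|p] // _ pm.
  (* Homological degree 0: the intersection defining [Zc] in degree 1 has no members, so it is the
     whole space. *)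
  by rewrite /Kker /Zc /= big_ord0; exact: addvSl.
apply/subvP => x; rewrite /Kker memv_cap => /andP [xZ]; rewrite /Bd memv_cap => /andP [_ xS].
have [pn|np] := ltnP p n'; last first.
  (* Top homological degree: the sum in the definition of [Bd] is empty, so there is no nonzero
     cycle. *)
  have ep : p = n' by lia.
  by move: xS; rewrite ep /= big_geq // memv0 => /eqP ->; rewrite mem0v.
move/memv_bigcap_ord: xZ => xZ.
have [|||y [z [-> Y Z S]]] := @source_distr F d q R q0 src n' b p x; first by [].
- by move=> i ip; rewrite -XfamE; exact: xZ.
- by move: xS; rewrite (eq_bigr _ (fun i _ => XfamE q b R n'.+1 i)).
apply: memv_add.
  by apply/memv_bigcap_ord => i ip; rewrite XfamE; exact: Y.
rewrite /Bd memv_cap (eq_bigr _ (fun i _ => XfamE q b R n'.+1 i)) S andbT.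
by apply/memv_bigcap_ord => i ip; rewrite XfamE; exact: Z.
Qed.

(** * The sign component of a word module *)

Section SignComponent.
Variables (F : fieldType) (q : F) (k n' : nat) (c : 'I_k -> F).
Local Notation n := n'.+1.
Local Notation N := (tens F k n).
Local Notation wT := (@wT F q k n' c).
Variable v : word k n.
Implicit Types (u w : word k n) (x y : N).

(* No letter with eigenvalue [q] is repeated; otherwise both lines are zero. *)
Definition good : bool := [forall i : 'I_n,
  (i.+1 < n)%N && (letter v i == letter v i.+1) ==> (c (letter v i) != q)].

Lemma goodP : reflect (forall i, (i.+1 < n)%N -> letter v i = letter v i.+1 ->
  c (letter v i) != q) good.
Proof.
apply: (iffP forallP) => [H i h e|H i].
  by have := H (Ordinal (ltnW h)); rewrite /= h e eqxx.
by apply/implyP => /andP [h /eqP]; exact: H.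
Qed.

(** Spanning vector of the common image of the [T_i - q] in the component of [v]: powers of [-q^-1],
    cleared of denominators so that the coefficients are polynomial in [q]. *)
Definition bv : N :=
  [ffun w => if good && csame w v then (-1) ^+ ninv w * q ^+ (n * n - ninv w) else 0].

(** Coordinate on the quotient of the component of [v] by the sum of the kernels of the
    [T_i - q]. *)
Definition bet : 'Hom(N, F^o) :=
  ffun_lin (fun w => (if good && csame w v then (-1) ^+ ninv w else 0) : F^o).

Lemma betE x : bet x = if good then \sum_(w | csame w v) (-1) ^+ ninv w * x w else 0.
Proof.
rewrite /bet ffun_linE; case: ifP => _; last first.
  by rewrite big1 // => w _; rewrite scaler0.
rewrite [RHS]big_mkcond; apply: eq_bigr => w _ /=; case: ifP => _; last by rewrite scaler0.
by rewrite /GRing.scale /= mulrC.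
Qed.

Hypothesis q0 : q != 0.
Hypothesis sv : wsorted v.

Lemma good_repeat w i : good -> csame w v -> (i.+1 < n)%N ->
  letter w i = letter w i.+1 -> c (letter w i) != q.
Proof.
move=> /goodP g cw h e; have [j [hj e1 e2]] := csame_repeat cw sv h e.
by rewrite -e1 g // e1 e2.
Qed.

Definition allA x := forall i, (i.+1 < n)%N -> x \in Wf q true wT i.
Definition KS : {vspace N} := (\sum_(0 <= j < n') Wf q false wT j)%VS.

Lemma bv_allA : allA bv.
Proof.
move=> i h; apply/memWf => // w; rewrite !ffunE csame_sw //; split.
  move=> lt; case: ifP => _; last by rewrite mulr0.
  have := ninv_le (sw i w); rewrite ninv_sw // => le.
  have -> : (n * n - ninv w = (n * n - (ninv w).+1).+1)%N by move: (n * n)%N le; lia.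
  by rewrite !exprS /gam; ring.
move=> e; rewrite /eps negbK => /eqP ec; case: ifP => // /andP [g cw].
by have := good_repeat g cw h e; rewrite ec eqxx.
Qed.

Lemma prc_bv : prc F v bv = bv.
Proof. by apply/ffunP => w; rewrite prcE !ffunE andbC; case: (csame w v). Qed.

(** Each swap multiplies the coordinate by a nonzero factor, so all coordinates are determined by
    the one at the sorted word. *)
Lemma allA_zero x : allA x -> prc F v x = x -> x v = 0 -> x = 0.
Proof.
move=> Ax px xv; apply/ffunP => w; rewrite ffunE.
case cw : (csame w v); last by rewrite -px prcE cw.
elim/word_ind: w cw => [w sw_ cw|w i h lt IH cw].
  by rewrite (wsorted_inj sw_ sv cw).
have /memWf := Ax i h => /(_ q0 h (sw i w)) [].
rewrite letter_swl // letter_swr // swK // => /(_ lt).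
rewrite IH ?csame_sw // => /esym/eqP.
by rewrite mulf_eq0 oppr_eq0 (negbTE q0) => /eqP.
Qed.

Lemma allA_line x : allA x -> prc F v x = x -> exists a, x = a *: bv.
Proof.
move=> Ax px; case: (boolP good) => [g|ng].
  have bvv : bv v = q ^+ (n * n) by rewrite ffunE g csame_refl ninv_wsorted // mul1r subn0.
  have nz : bv v != 0 by rewrite bvv expf_eq0 (negbTE q0) andbF.
  exists (x v / bv v); apply: subr0_eq; apply: allA_zero.
  - by move=> i h; rewrite memvB ?memvZ // ?Ax // bv_allA.
  - by rewrite linearB linearZ /= px prc_bv.
  - have -> (a : F) : (x - a *: bv) v = x v - a * bv v by rewrite !ffunE.
    by rewrite mulfVK ?subrr.
exists 0; rewrite scale0r; apply: allA_zero => //.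
move: ng; rewrite negb_forall => /existsP [i]; rewrite negb_imply negbK.
move=> /andP [/andP [h /eqP e] /eqP ce].
have /memWf := Ax i h => /(_ q0 h v) [_ ->] //.
by rewrite /eps ce eqxx.
Qed.

(** The sum of the basis vectors of [w] and [sw i w] lies in Ker (T_i - q), so a swap changes the
    sign modulo [KS]. *)
Lemma ev_KS w : csame w v -> ev F w - (-1) ^+ ninv w *: ev F v \in KS.
Proof.
elim/word_ind: w => [w sw_ cw|w i h lt IH cw].
  by rewrite (wsorted_inj sw_ sv cw) ninv_wsorted // expr0 scale1r subrr mem0v.
have {}IH := IH (etrans (csame_sw w v h) cw).
rewrite (ninv_swD h lt) exprS mulN1r scaleNr opprK.
have -> : ev F w + (-1) ^+ ninv (sw i w) *: ev F v =
   (ev F w + ev F (sw i w)) - (ev F (sw i w) - (-1) ^+ ninv (sw i w) *: ev F v).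
  by rewrite opprB addrACA subrr addr0.
apply: memvB => //; apply: (@memv_sum_nat _ _ _ _ _ i); first by lia.
rewrite /Wf memv_ker add_lfunE opp_lfunE scale_lfunE id_lfunE linearD /= !wT_ev //.
rewrite letter_swl // letter_swr // swK // lt ltnNge (ltnW lt) /= scalerDr scalerBl scale1r.
by apply/eqP/ffunP => u; rewrite !ffunE /GRing.scale /=; ring.
Qed.

Lemma bad_KS : ~~ good -> ev F v \in KS.
Proof.
rewrite negb_forall => /existsP [i]; rewrite negb_imply negbK.
move=> /andP [/andP [h /eqP e] /eqP ce].
apply: (@memv_sum_nat _ _ _ _ _ i); first by lia.
rewrite /Wf memv_ker add_lfunE opp_lfunE scale_lfunE id_lfunE wT_ev // -e ltnn ce.
by rewrite subrr.
Qed.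

Lemma mod_KS x : prc F v x = x -> x - bet x *: ev F v \in KS.
Proof.
move=> px; have H w : x w *: (ev F w - (if good && csame w v then (-1) ^+ ninv w else 0) *: ev F v) \in KS.
  case cw : (csame w v); last first.
    have -> : x w = 0 by rewrite -px prcE cw.
    by rewrite (scale0r (ev F w - _)); exact: mem0v.
  apply: memvZ; case: (boolP good) => g /=; first exact: ev_KS.
  rewrite scale0r subr0 -[ev F w](subrK ((-1) ^+ ninv w *: ev F v)).
  by rewrite memvD ?ev_KS // memvZ // bad_KS.
have -> : x - bet x *: ev F v = \sum_w x w *: (ev F w -
     (if good && csame w v then (-1) ^+ ninv w else 0) *: ev F v).
  under [RHS]eq_bigr => w _ do rewrite scalerBr scalerA.
  by rewrite sumrB -ev_expand /bet ffun_linE scaler_suml.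
by apply: memv_suml => w _.
Qed.

(** A word and its swap at [i] have equal coordinates and opposite signs, so they cancel; words with
    equal letters there contribute zero because [good] excludes repetition of a letter with
    eigenvalue [q]. *)
Lemma bet_ker i x : (i.+1 < n)%N -> x \in Wf q false wT i -> bet x = 0.
Proof.
move=> h /memWf => /(_ q0 h) Wx; rewrite betE; case: ifP => // g.
rewrite (bigID (fun w => letter w i < letter w i.+1)%N) /=.
rewrite (bigID (fun w => letter w i.+1 < letter w i)%N
   (fun w => csame w v && ~~ (letter w i < letter w i.+1)%N)) /=.
rewrite [X in _ + (_ + X)]big1 ?addr0; last first.
  move=> w /andP [/andP [cw n1] n2].
  have e : letter w i = letter w i.+1.
    by apply: val_inj; apply/eqP; move: n1 n2; rewrite -!leqNgt eqn_leq => -> ->.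
  have [_ ->] := Wx w; rewrite ?mulr0 //; exact: good_repeat.
rewrite [X in _ + X](reindex_inj (inv_inj (swK h))) /=.
rewrite [X in _ + X](eq_bigl (fun w => csame w v && (letter w i < letter w i.+1)%N)); last first.
  move=> w; rewrite csame_sw // letter_swl // letter_swr // -andbA; congr (_ && _).
  by case: ltngtP.
rewrite -big_split big1 //= => w /andP [cw lt].
by have [-> // _] := Wx w; rewrite ninv_sw // exprS /gam; ring.
Qed.

Lemma bet_KS x : x \in KS -> bet x = 0.
Proof.
move: x; apply: sumv_nat_ind => [|x y Hx Hy|j jn x].
- by rewrite linear0.
- by rewrite linearD /= Hx Hy addr0.
- by apply: bet_ker; lia.
Qed.

Section Endo.
Variable E : 'End(N).
Hypothesis eE : equivariant n wT wT E.
Hypothesis pE : forall x, prc F v (E x) = E x.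

Lemma endo_bv : exists a, E bv = a *: bv.
Proof. by apply: allA_line => // i h; apply: (Wf_equivariant eE) => //; exact: bv_allA. Qed.

Lemma endo_KS x : x \in KS -> E x \in KS.
Proof.
move: x; apply: sumv_nat_ind => [|x y Hx Hy|j jn x Wx].
- by rewrite linear0 mem0v.
- by rewrite linearD memvD.
- by apply: (memv_sum_nat jn); apply: (Wf_equivariant eE) => //; lia.
Qed.

Lemma endo_bet x : prc F v x = x -> bet (E x) = bet x * bet (E (ev F v)).
Proof.
move=> /mod_KS/endo_KS/bet_KS; rewrite linearB linearZ /= linearB linearZ /=.
by move/eqP; rewrite subr_eq0 => /eqP.
Qed.

(** When [bet] is nonzero on [bv], the line of [bv] maps isomorphically onto the quotient by [KS],
    so both carry the same scalar. *)
Lemma endo_generic a : bet bv != 0 -> E bv = a *: bv -> bet (E (ev F v)) = a.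
Proof.
move=> nz Ea; have := endo_bet prc_bv; rewrite Ea linearZ /= => /eqP.
by rewrite [_ *: _]mulrC (inj_eq (mulfI nz)) => /eqP.
Qed.
End Endo.
End SignComponent.

(** * Deformation to a generic parameter *)

Section Specialization.
Variables (F : fieldType) (q : F).
Local Notation K := {fraction {poly F}}.
Local Notation "p %:K" := (tofrac p : K) (at level 2).

(** Evaluation at [q], kept as a relation because only the fractions that are polynomials receive a
    value. *)
Definition spec (r : K) (x : F) := exists2 p : {poly F}, r = p%:K & p.[q] = x.

Lemma spec_inj r x y : spec r x -> spec r y -> x = y.
Proof. by move=> [p -> <-] [p' /eqP]; rewrite tofrac_eq => /eqP -> <-. Qed.

Lemma spec0 : spec 0 0. Proof. by exists 0; rewrite ?tofrac0 // horner0. Qed.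
Lemma spec1 : spec 1 1. Proof. by exists 1; rewrite ?tofrac1 // hornerC. Qed.
Lemma specX : spec ('X%:K) q. Proof. by exists 'X; rewrite // hornerX. Qed.

Lemma specD r s x y : spec r x -> spec s y -> spec (r + s) (x + y).
Proof. by move=> [p -> <-] [p' -> <-]; exists (p + p'); rewrite ?tofracD // hornerD. Qed.

Lemma specN r x : spec r x -> spec (- r) (- x).
Proof. by move=> [p -> <-]; exists (- p); rewrite ?tofracN // hornerN. Qed.

Lemma specM r s x y : spec r x -> spec s y -> spec (r * s) (x * y).
Proof. by move=> [p -> <-] [p' -> <-]; exists (p * p'); rewrite ?tofracM // hornerM. Qed.

Lemma specXn r x m : spec r x -> spec (r ^+ m) (x ^+ m).
Proof. by move=> h; elim: m => [|m IH]; [exact: spec1|rewrite !exprS; exact: specM]. Qed.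

Lemma spec_sum (I : finType) (P : pred I) (f : I -> K) (g : I -> F) :
  (forall i, P i -> spec (f i) (g i)) -> spec (\sum_(i | P i) f i) (\sum_(i | P i) g i).
Proof.
move=> H; elim/big_ind2: _ => [|a b a' b'|i Pi]; [exact: spec0|exact: specD|exact: H].
Qed.
End Specialization.

Section Deformation.
Variables (F : fieldType) (q : F) (k n' : nat) (c : 'I_k -> F).
Local Notation n := n'.+1.
Local Notation K := {fraction {poly F}}.
Local Notation "p %:K" := (tofrac p : K) (at level 2).
Local Notation N := (tens F k n).
Local Notation TF := (@wT F q k n' c).
Hypothesis q0 : q != 0.
Hypothesis hc : forall a, (c a - q) * (c a + 1) = 0.
Variable v : word k n.
Hypothesis sv : wsorted v.
Hypothesis gv : good q c v.
Variable E : 'End(N).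
Hypothesis eE : equivariant n TF TF E.
Hypothesis pE : forall x, prc F v (E x) = E x.

Let t : K := 'X%:K.
(** The eigenvalue [q] becomes the variable and [-1] stays; if [q = -1], all letters follow the
    variable. *)
Let c' (a : 'I_k) : K := if c a == q then t else -1.
Local Notation TK := (@wT K t k n' c').
Local Notation N' := (tens K k n).

Lemma gen_neq0 : t != 0.
Proof. by rewrite /t -tofrac0 tofrac_eq polyX_eq0. Qed.

Lemma gen_quad a : (c' a - t) * (c' a + 1) = 0.
Proof. by rewrite /c'; case: ifP => _; rewrite ?subrr ?mul0r // addNr mulr0. Qed.

Lemma spec_c a : spec q (c' a) (c a).
Proof.
rewrite /c'; case: eqP => [->|ne]; first exact: specX.
have := hc a => /eqP; rewrite mulf_eq0 subr_eq0 addr_eq0 => /orP [/eqP //|/eqP ->].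
by apply: specN; exact: spec1.
Qed.

Lemma good_gen : good t c' v.
Proof.
apply/goodP => i h e; have /goodP/(_ i h e) := gv; rewrite /c' => /negbTE ->.
rewrite /t -tofrac1 -tofracN tofrac_eq -subr_eq0 -opprD oppr_eq0 addrC -[1]/(1%:P).
by rewrite -size_poly_eq0 size_XaddC.
Qed.

Let x0 : N := E (ev F v).

Lemma endo_ev_same i : (i.+1 < n)%N -> letter v i = letter v i.+1 -> TF i x0 = - x0.
Proof.
move=> h e; rewrite -eE // wT_ev // -e ltnn linearZ /=.
have /goodP/(_ i h e) := gv; have := hc (letter v i) => /eqP.
by rewrite mulf_eq0 subr_eq0 addr_eq0 => /orP [->//|/eqP -> _]; rewrite scaleN1r.
Qed.

(* [x0] is determined by its values up to the factor [(-q)] per inversion imposed by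
   the sign eigenspaces; replacing [q] by ['X] in that factor keeps it in them. *)
Let xp (w : word k n) : {poly F} :=
  (x0 w * q ^- (n * n - ninv w)) *: 'X^(n * n - ninv w).

Let x' : N' := [ffun w => (xp w)%:K].

Lemma spec_lift w : spec q (x' w) (x0 w).
Proof.
exists (xp w); first by rewrite ffunE.
by rewrite /xp hornerZ hornerXn mulfVK // expf_eq0 (negbTE q0) andbF.
Qed.

Lemma lift_asc w i : (i.+1 < n)%N -> (letter w i < letter w i.+1)%N ->
  TF i x0 = - x0 -> 'X * xp (sw i w) = - xp w.
Proof.
move=> h lt /ffunP/(_ w); rewrite wTE /pcf /qcf lt !ffunE mul0r add0r => e.
rewrite /xp; have := ninv_le (sw i w); rewrite ninv_sw // => le.
have -> : (n * n - ninv w = (n * n - (ninv w).+1).+1)%N by move: (n * n)%N le; lia.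
have -> : x0 w = - (q * x0 (sw i w)) by rewrite e opprK.
set m := (_ - _)%N; rewrite -scalerAr -exprS -scaleNr; congr (_ *: _).
by rewrite mulNr opprK exprS invfM mulrACA mulfV // mul1r.
Qed.

(** The stabilizer of [v] acts on the lifted vector by its character, which is what [wpsi] requires
    of a prescribed image of [v]. *)
Lemma lift_same i : (i.+1 < n)%N -> letter v i = letter v i.+1 ->
  TK i x' = c' (letter v i) *: x'.
Proof.
move=> h e; have xs := endo_ev_same h e.
have -> : c' (letter v i) = -1 by rewrite /c' (negbTE (goodP _ _ _ gv i h e)).
rewrite scaleN1r; apply/ffunP => w; rewrite wTE /pcf /qcf !ffunE.
case: ltngtP => [lt|gt|/val_inj eq].
- by rewrite mul0r add0r /t -tofracM (lift_asc h lt xs) tofracN.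
- have lt : (letter (sw i w) i < letter (sw i w) i.+1)%N by rewrite letter_swl // letter_swr.
  have := lift_asc h lt xs; rewrite swK // => e1.
  have -> : xp (sw i w) = - ('X * xp w) by rewrite e1 opprK.
  by rewrite mul1r tofracN tofracM -/t; ring.
rewrite mul0r addr0; case cw : (csame w v).
  by rewrite /c' (negbTE (good_repeat sv gv cw h eq)) mulN1r.
have -> : xp w = 0 by rewrite /xp /x0 -pE prcE cw mul0r scale0r.
by rewrite tofrac0 mulr0 oppr0.
Qed.

Let base (w : word k n) : N' := if w == v then x' else 0.

Let E' : 'End(N') := (prc K v \o wpsi TK base)%VF.

Lemma deform_equivariant : equivariant n TK TK E'.
Proof.
apply: comp_equivariant (@prc_equivariant K t k n' c' v).
apply: (wpsi_equivariant (wT_hmod n' gen_quad)).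
move=> w _ i h e; rewrite /base; case: eqP => [ew|_]; last by rewrite linear0 scaler0.
by rewrite ew lift_same // -ew.
Qed.

Lemma prc_deform x : prc K v (E' x) = E' x.
Proof. by apply/ffunP => w; rewrite comp_lfunE !prcE; case: (csame w v). Qed.

Lemma deform_ev : E' (ev K v) = x'.
Proof.
rewrite comp_lfunE wpsi_sorted // /base eqxx; apply/ffunP => w; rewrite prcE.
case cw : (csame w v) => //; rewrite ffunE /xp /x0 -pE prcE cw mul0r scale0r.
by rewrite tofrac0.
Qed.

Lemma spec_pcf a b : spec q (pcf t c' a b) (pcf q c a b).
Proof.
rewrite /pcf; case: ifP => _; first exact: spec0.
case: ifP => _; last exact: spec_c.
by apply: specD; [exact: specX|apply: specN; exact: spec1].
Qed.

Lemma spec_qcf (a b : 'I_k) : spec q (qcf t a b) (qcf q a b).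
Proof.
rewrite /qcf; case: ifP => _; first exact: specX.
by case: ifP => _; [exact: spec1|exact: spec0].
Qed.

(** The basis vector of [w] is reached from that of [v] by operators whose coefficients specialize;
    equivariance transfers this to [E'] and [E]. *)
Lemma spec_deform w : csame w v -> forall u, spec q (E' (ev K w) u) (E (ev F w) u).
Proof.
elim/word_ind: w => [w sw_ cw|w i h lt IH cw] u.
  by rewrite (wsorted_inj sw_ sv cw) deform_ev; exact: spec_lift.
have {}IH := IH (etrans (csame_sw w v h) cw).
have lt' : (letter (sw i w) i < letter (sw i w) i.+1)%N by rewrite letter_swl // letter_swr.
have -> : ev K w = TK i (ev K (sw i w)) by rewrite wT_ev // lt' swK.
have -> : ev F w = TF i (ev F (sw i w)) by rewrite wT_ev // lt' swK.
rewrite deform_equivariant // eE // !wTE; apply: specD; apply: specM; rewrite ?IH //.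
- exact: spec_pcf.
- exact: spec_qcf.
Qed.

Lemma spec_bv w : spec q (bv t c' v w) (bv q c v w).
Proof.
rewrite !ffunE gv good_gen /=; case: ifP => _; last exact: spec0.
by apply: specM; apply: specXn; [apply: specN; exact: spec1|exact: specX].
Qed.

(* The coefficient of ['X^(n * n)] is [1]: [v] is the only word of its content without
   inversions. *)
Lemma bet_bv_gen : bet t c' v (bv t c' v) != 0.
Proof.
rewrite betE good_gen.
have -> : \sum_(w | csame w v) (-1) ^+ ninv w * bv t c' v w =
    (\sum_(w | csame w v) 'X^(n * n - ninv w) : {poly F})%:K.
  rewrite raddf_sum; apply: eq_bigr => w cw; rewrite ffunE good_gen cw /=.
  by rewrite mulrA -exprD addnn -mul2n exprM sqrrN !expr1n mul1r /t tofracXn.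
rewrite -tofrac0 tofrac_eq; apply/eqP => /(congr1 (fun p : {poly F} => p`_(n * n))).
rewrite coef0 coef_sum (bigD1 v) ?csame_refl //= coefXn ninv_wsorted // subn0 eqxx.
rewrite big1 ?addr0 => [/eqP|w /andP [cw wv]]; first by rewrite oner_eq0.
rewrite coefXn; case: eqP => // e; case/eqP: wv.
apply: wsorted_inj => //; apply: wsorted_ninv0.
by have := ninv_le w; move: (n * n)%N e; lia.
Qed.

(** Over the function field [endo_generic] applies to [E'], with scalar [a']. The product
    [a' * t ^+ (n * n)] is read twice: through [bet], and as the coordinate at [v] of [E'] applied
    to the generic [bv]. The two readings specialize to the two sides times a power of [q]. *)
Lemma bet_endo a : E (bv q c v) = a *: bv q c v -> bet q c v (E (ev F v)) = a.
Proof.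
move=> Ea.
have [a' Ea'] := endo_bv gen_neq0 sv deform_equivariant prc_deform.
have := endo_generic gen_neq0 sv deform_equivariant bet_bv_gen Ea'; rewrite deform_ev => b'.
have bvv : bv q c v v = q ^+ (n * n) by rewrite ffunE gv csame_refl ninv_wsorted // mul1r subn0.
have bvv' : bv t c' v v = t ^+ (n * n) by rewrite ffunE good_gen csame_refl ninv_wsorted // mul1r subn0.
have nz : q ^+ (n * n) != 0 by rewrite expf_eq0 (negbTE q0) andbF.
apply: (mulIf nz).
have S1 : spec q (a' * t ^+ (n * n)) (bet q c v (E (ev F v)) * q ^+ (n * n)).
  apply: specM; last by apply: specXn; exact: specX.
  rewrite -b' !betE good_gen gv; apply: spec_sum => w cw; apply: specM; last exact: spec_lift.
  by apply: specXn; apply: specN; exact: spec1.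
have S2 : spec q (a' * t ^+ (n * n)) (a * q ^+ (n * n)).
  have -> : a' * t ^+ (n * n) = E' (bv t c' v) v by rewrite Ea' -bvv' [in RHS]ffunE.
  have -> : a * q ^+ (n * n) = E (bv q c v) v by rewrite Ea -bvv [in RHS]ffunE.
  rewrite [bv t c' v]ev_expand [bv q c v]ev_expand !linear_sum /= !sum_ffunE.
  apply: spec_sum => w _; rewrite !linearZ /=.
  have scF (b : F) (x : N) : (b *: x) v = b * x v by rewrite ffunE.
  have scK (b : K) (x : N') : (b *: x) v = b * x v by rewrite ffunE.
  rewrite scF scK.
  case cw : (csame w v); first by apply: specM; [exact: spec_bv|exact: spec_deform].
  have -> : bv t c' v w = 0 by rewrite ffunE cw andbF.
  have -> : bv q c v w = 0 by rewrite ffunE cw andbF.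
  by rewrite !mul0r; exact: spec0.
exact: spec_inj S1 S2.
Qed.
End Deformation.

(** * The dimension of the dual coalgebra *)

Lemma dim_eqidem_add (F : fieldType) (V : vectType F) n (t : nat -> 'End(V)) (e1 e2 : 'End(V))
    (X : {vspace V}) :
  eqidem n t e1 -> eqidem n t e2 -> (forall x, e1 (e2 x) = 0) -> (forall x, e2 (e1 x) = 0) ->
  (forall x, x \in X -> e1 x \in X) -> (forall x, x \in X -> e2 x \in X) ->
  \dim ((e1 + e2) @: X) = (\dim (e1 @: X) + \dim (e2 @: X))%N.
Proof.
move=> [_ i1] [_ i2] e12 e21 X1 X2.
have -> : ((e1 + e2) @: X = e1 @: X + e2 @: X)%VS.
  apply/eqP; rewrite eqEsubv subv_add; apply/and3P; split; apply/subvP => y /memv_imgP [x xX ->].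
  - by rewrite add_lfunE memv_add // memv_img.
  - apply/memv_imgP; exists (e1 x); first exact: X1.
    by rewrite add_lfunE i1 e21 addr0.
  - apply/memv_imgP; exists (e2 x); first exact: X2.
    by rewrite add_lfunE i2 e12 add0r.
rewrite dimv_disjoint_sum //; apply/eqP; rewrite -subv0; apply/subvP => y.
move=> /memv_capP [/memv_imgP [a _ ya] /memv_imgP [b _ yb]].
by rewrite memv0 ya -i1 -ya yb e12.
Qed.

(** * The common image and the sum of kernels have complementary dimensions *)

Section SourceDim.
Variables (F : fieldType) (d : nat) (q : F) (R : 'End(tens F d 2)).
Hypothesis q0 : q != 0.
Hypothesis src : onedim_source q R.
Variable n' : nat.
Local Notation n := n'.+1.
Local Notation V := (tens F d n).
Local Notation T := (Tfam n R).

Let A : {vspace V} := (\bigcap_(i < n') Wf q true T i)%VS.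
Let S : {vspace V} := (\sum_(0 <= j < n') Wf q false T j)%VS.

Lemma cap_Wf_stable e x : equivariant n T T e -> x \in A -> e x \in A.
Proof.
move=> ee /memv_bigcap_ord Ax; apply/memv_bigcap_ord => i h.
by apply: (Wf_equivariant ee) => //; exact: Ax.
Qed.

Lemma sum_Wf_map (M N : vectType F) (t : nat -> 'End(M)) (s : nat -> 'End(N)) f x :
  equivariant n t s f -> x \in (\sum_(0 <= j < n') Wf q false t j)%VS ->
  f x \in (\sum_(0 <= j < n') Wf q false s j)%VS.
Proof.
move=> ef; move: x; apply: sumv_nat_ind => [|x y Hx Hy|j jn x Wx].
- by rewrite linear0 mem0v.
- by rewrite linearD memvD.
- by apply: (memv_sum_nat jn); apply: (Wf_equivariant ef) => //; lia.
Qed.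

(** All three dimensions are additive over orthogonal idempotents, which leaves an indecomposable
    image. There [e @: A] is the line of [psi b] and [e @: S] is the kernel of the functional [g] on
    the image, so the point is that [psi b] and [g] vanish together. *)
Lemma source_dim_idem e : eqidem n T e ->
  (\dim (e @: A) + \dim (e @: S) = \dim (limg e))%N.
Proof.
apply: (@eqidem_ind F V n T (fun e => (\dim (e @: A) + \dim (e @: S) = \dim (limg e))%N)).
- by rewrite !lim0g dimv0.
- move=> e1 e2 i1 i2 e12 e21 H1 H2.
  have dim_add (X : {vspace V}) : (forall (e : 'End(V)) x, equivariant n T T e -> x \in X -> e x \in X) ->
      \dim ((e1 + e2) @: X) = (\dim (e1 @: X) + \dim (e2 @: X))%N.
    move=> H; apply: (dim_eqidem_add i1 i2 e12 e21) => x xX; apply: H => //.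
      by case: i1.
    by case: i2.
  rewrite (dim_add A); last exact: cap_Wf_stable.
  rewrite (dim_add S); last by move=> f x; exact: sum_Wf_map.
  by rewrite (dim_add fullv) => [|*]; rewrite ?memvf // addnACA H1 H2.
move=> {}e ide ind.
have [c [v [phi [psi [hc sv [ephi epsi] [pp pe ep] pv]]]]] := source_factor q0 src ide ind.
pose E := (phi \o psi)%VF.
have eE : equivariant n (wT q n' c) (wT q n' c) E := comp_equivariant epsi ephi.
have pE x : prc F v (E x) = E x by rewrite comp_lfunE pv.
pose b := bv q c v; pose B := bet q c v; pose g := (B \o phi)%VF.
have dA : (e @: A)%VS = <[psi b]>%VS.
  apply/eqP; rewrite eqEsubv; apply/andP; split.
    apply/subvP => y /memv_imgP [x /memv_bigcap_ord Ax ->].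
    have Aphi : allA q c (phi x).
      by move=> i h; apply: (Wf_equivariant ephi) => //; exact: Ax.
    have [r er] := allA_line q0 sv Aphi (pv x).
    by rewrite -pp er linearZ /= memvZ // memv_line.
  rewrite -memvE -ep memv_img //; apply/memv_bigcap_ord => i h.
  by apply: (Wf_equivariant epsi) => //; apply: bv_allA.
have dS : (e @: S)%VS = (limg e :&: lker g)%VS.
  apply/eqP; rewrite eqEsubv; apply/andP; split; apply/subvP => y.
    move=> /memv_imgP [x xS ->]; rewrite memv_cap memv_img ?memvf //=.
    by rewrite memv_ker comp_lfunE pe (bet_KS q0 sv (x := phi x)) // (sum_Wf_map ephi).
  move=> /memv_capP [yU]; rewrite memv_ker comp_lfunE => /eqP gy.
  have := mod_KS c q0 sv (pv y); rewrite [X in X *: _]gy scale0r subr0 => /(sum_Wf_map epsi).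
  by rewrite pp => eyS; rewrite -(limg_idem ide yU) -(proj2 ide) memv_img.
rewrite dA dS dim_vline -[RHS](limg_ker_dim g) addnC; congr (_ + _)%N.
have gU1 : (\dim (g @: limg e) <= 1)%N.
  by apply: leq_trans (dimvS (subvf _)) _; rewrite dimvf /dim /=.
suff -> : (psi b != 0) = (g @: limg e != 0)%VS.
  by move: gU1; rewrite -dimv_eq0; case: (\dim _) => [|[]].
case: (boolP (good q c v)) => [gv|ng]; last first.
  have -> : b = 0 by apply/ffunP => w; rewrite !ffunE (negbTE ng).
  rewrite linear0 eqxx; apply/esym/negbTE; rewrite negbK -subv0.
  apply/subvP => y /memv_imgP [x _ ->].
  by rewrite comp_lfunE /B betE (negbTE ng) mem0v.
(* With [good], [E] acts by the one scalar [a] on both lines, and each of the two conditions turns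
   out to mean [a != 0]. *)
have [a Ea] := endo_bv q0 sv eE pE.
have Ba := bet_endo q0 hc sv gv eE pE Ea.
have bn0 : b != 0.
  apply/eqP => /ffunP/(_ v); rewrite !ffunE gv csame_refl ninv_wsorted // mul1r subn0.
  by move/eqP; rewrite expf_eq0 (negbTE q0) andbF.
have -> : (psi b != 0) = (a != 0).
  congr (~~ _); apply/eqP/eqP => [pb0|a0].
    have : E b = 0 by rewrite comp_lfunE pb0 linear0.
    by rewrite Ea => /eqP; rewrite scaler_eq0 (negbTE bn0) orbF => /eqP.
  by rewrite -ep -pp -[phi (psi b)]comp_lfunE -/E Ea a0 scale0r linear0.
congr (~~ _); apply/eqP/eqP => [a0|gU0].
  apply/eqP; rewrite -subv0; apply/subvP => y /memv_imgP [x xU ->].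
  rewrite comp_lfunE -pe -pp -[phi (psi _)]comp_lfunE -/E /B (endo_bet q0 sv eE (pv x)).
  by rewrite Ba a0 mulr0 mem0v.
(* A test vector on which [g] takes the value [a]. *)
have : g (psi (ev F v)) \in (g @: limg e)%VS by rewrite memv_img // -ep memv_img // memvf.
by rewrite gU0 memv0 !comp_lfunE -[phi (psi _)]comp_lfunE -/E Ba => /eqP.
Qed.

Lemma source_dim : (\dim A + \dim S = \dim {:V})%N.
Proof.
have := source_dim_idem (id_eqidem R n').
by have li (U : {vspace V}) : (\1%VF @: U)%VS = U by [rewrite lim1g]; rewrite !li.
Qed.
End SourceDim.

(** * Hilbert series *)

Section TensorSplit.
Variables (F : fieldType) (d p r : nat).
Local Notation Vp := (tens F d p).
Local Notation Vr := (tens F d r).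
Local Notation Vm := (tens F d (p + r)%N).
Implicit Types (u : word d p) (s : word d r) (x : Vm).

Definition catw u s : word d (p + r)%N :=
  [ffun j => match split j with inl a => u a | inr b => s b end].
Definition lw (w : word d (p + r)%N) : word d p := [ffun a => w (lshift r a)].
Definition rw (w : word d (p + r)%N) : word d r := [ffun b => w (rshift p b)].

Lemma lw_cat u s : lw (catw u s) = u.
Proof. by apply/ffunP => a; rewrite !ffunE -[lshift r a]/(unsplit (inl a)) unsplitK. Qed.

Lemma rw_cat u s : rw (catw u s) = s.
Proof. by apply/ffunP => b; rewrite !ffunE -[rshift p b]/(unsplit (inr b)) unsplitK. Qed.

Lemma cat_lr w : catw (lw w) (rw w) = w.
Proof.
apply/ffunP => j; rewrite ffunE -{2}[j]splitK.
by case: (split j) => a /=; rewrite ffunE.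
Qed.

Definition colx x s : Vp := [ffun u => x (catw u s)].
Definition rowx x u : Vr := [ffun s => x (catw u s)].

(** [Q] is A (x) I, described as the intersection of A (x) V_r and V_p (x) I; matrices of
    coefficients in bases of [A] and [I] map bijectively onto it. *)
Lemma dim_cols_rows (A : {vspace Vp}) (I : {vspace Vr}) (Q : {vspace Vm}) :
  (forall x, x \in Q <-> (forall s, colx x s \in A) /\ (forall u, rowx x u \in I)) ->
  \dim Q = (\dim A * \dim I)%N.
Proof.
move=> QP; set a := \dim A; set b := \dim I.
pose g0 (Y : 'M[F]_(a, b)) : Vm := [ffun w =>
  \sum_i \sum_j Y i j * ((vbasis A)`_i (lw w) * (vbasis I)`_j (rw w))].
have lg : linear g0.
  move=> k Y Z; apply/ffunP => w; rewrite !ffunE scaler_sumr -big_split; apply: eq_bigr => i _ /=.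
  rewrite scaler_sumr -big_split; apply: eq_bigr => j _ /=.
  by rewrite !mxE /GRing.scale /=; ring.
pose g : 'Hom('M[F]_(a, b), Vm) := linfun g0.
have gE Y : g Y = g0 Y by exact: linfun_linE.
have gcol Y s : colx (g Y) s = \sum_i (\sum_j Y i j * (vbasis I)`_j s) *: (vbasis A)`_i.
  apply/ffunP => u; rewrite gE !ffunE lw_cat rw_cat sum_ffunE; apply: eq_bigr => i _.
  rewrite ffunE /GRing.scale /= mulr_suml; apply: eq_bigr => j _.
  by rewrite mulrAC mulrA.
have grow Y u : rowx (g Y) u = \sum_j (\sum_i Y i j * (vbasis A)`_i u) *: (vbasis I)`_j.
  apply/ffunP => s; rewrite gE !ffunE lw_cat rw_cat sum_ffunE exchange_big; apply: eq_bigr => j _.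
  rewrite ffunE /GRing.scale /= mulr_suml; apply: eq_bigr => i _.
  by rewrite mulrA.
have bA i : (vbasis A)`_i \in A.
  have [h|h] := ltnP i a; first by apply: vbasis_mem; apply: mem_nth; rewrite size_tuple.
  by rewrite nth_default ?mem0v // size_tuple.
have bI i : (vbasis I)`_i \in I.
  have [h|h] := ltnP i b; first by apply: vbasis_mem; apply: mem_nth; rewrite size_tuple.
  by rewrite nth_default ?mem0v // size_tuple.
have /freeP fA := basis_free (vbasisP A).
have /freeP fI := basis_free (vbasisP I).
have ginj : lker g = 0%VS.
  apply/eqP; rewrite -subv0; apply/subvP => Y; rewrite memv_ker memv0 => /eqP gY.
  apply/eqP/matrixP => i j; rewrite mxE.
  apply: (fI (fun j => Y i j)); apply/ffunP => s; rewrite sum_ffunE ffunE.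
  have := fA (fun i => \sum_j Y i j * (vbasis I)`_j s); rewrite -gcol gY => H.
  have := H _ i; have -> : colx 0 s = 0 by apply/ffunP => u; rewrite !ffunE.
  move=> /(_ erefl) E; rewrite -[RHS]E; apply: eq_bigr => l _.
  by rewrite ffunE.
have gimg : limg g = Q.
  apply/eqP; rewrite eqEsubv; apply/andP; split; apply/subvP => x.
    move=> /memv_imgP [Y _ ->]; apply/QP; split=> [s|u].
      by rewrite gcol; apply: memv_suml => i _; rewrite memvZ.
    by rewrite grow; apply: memv_suml => i _; rewrite memvZ.
  move=> /QP [xA xI].
  (* Coefficients of the columns over the basis of [A]; each is a combination of rows of [x], hence
     lies in [I]. *)
  pose ci (i : 'I_a) : Vr := [ffun s => coord (vbasis A) i (colx x s)].
  have ciI i : ci i \in I.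
    have -> : ci i = \sum_u coord (vbasis A) i (ev F u) *: rowx x u.
      apply/ffunP => s; rewrite ffunE (ev_expand (colx x s)) linear_sum sum_ffunE.
      by apply: eq_bigr => u _; rewrite linearZ /= !ffunE /GRing.scale /= mulrC.
    by apply: memv_suml => u _; rewrite memvZ.
  apply/memv_imgP; exists (\matrix_(i, j) coord (vbasis I) j (ci i)); first by rewrite memvf.
  apply/ffunP => w; rewrite -(cat_lr w).
  have := congr1 (fun y : Vp => y (lw w)) (coord_vbasis (xA (rw w))).
  rewrite ffunE => ->.
  have := congr1 (fun y : Vp => y (lw w)) (gcol (\matrix_(i, j) coord (vbasis I) j (ci i)) (rw w)).
  rewrite ffunE => ->; rewrite !sum_ffunE; apply: eq_bigr => i _; rewrite !ffunE; congr (_ *: _).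
  have := congr1 (fun y : Vr => y (rw w)) (coord_vbasis (ciI i)).
  rewrite ffunE => ->; rewrite sum_ffunE; apply: eq_bigr => j _.
  by rewrite ffunE mxE.
by rewrite -gimg limg_dim_eq ?ginj ?capv0 // dimvf /dim /=.
Qed.

End TensorSplit.

Lemma TopE (F : fieldType) d n (R : 'End(tens F d 2)) i (x : tens F d n) w
    (h1 : (i < n)%N) (h2 : (i.+1 < n)%N) :
  Top n R i x w = R [ffun u => x (splice w i u)]
    [ffun k : 'I_2 => if val k == 0%N then w (Ordinal h1) else w (Ordinal h2)].
Proof.
rewrite /Top linfun_linE.
  by rewrite ffunE (insubT (fun j => (j < n)%N) h1) (insubT (fun j => (j < n)%N) h2).
move=> a y z; apply/ffunP => u; rewrite !ffunE.
case: insubP => [j1 _ _|_]; last by rewrite scaler0 addr0.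
case: insubP => [j2 _ _|_]; last by rewrite scaler0 addr0.
have -> : [ffun u0 => (a *: y + z) (splice u i u0)] =
    a *: [ffun u0 => y (splice u i u0)] + [ffun u0 => z (splice u i u0)] :> tens F d 2.
  by apply/ffunP => u0; rewrite !ffunE.
by rewrite linearP !ffunE.
Qed.

(** * Terms of the Koszul complex as tensor products *)

Section TopSplit.
Variables (F : fieldType) (d p r : nat) (q : F) (R : 'End(tens F d 2)).
Local Notation Vp := (tens F d p).
Local Notation Vr := (tens F d r).
Local Notation Vm := (tens F d (p + r)%N).
Implicit Types (u : word d p) (s : word d r) (x : Vm).

Lemma cat_lshift u s a : catw u s (lshift r a) = u a.
Proof. by rewrite ffunE -[lshift r a]/(unsplit (inl a)) unsplitK. Qed.

Lemma cat_rshift u s b : catw u s (rshift p b) = s b.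
Proof. by rewrite ffunE -[rshift p b]/(unsplit (inr b)) unsplitK. Qed.

Lemma splice_catl u s i y : (i.+1 < p)%N -> splice (catw u s) i y = catw (splice u i y) s.
Proof.
move=> h; apply/ffunP => j; rewrite -[j]splitK; case: (split j) => a /=.
  by rewrite cat_lshift [LHS]ffunE [RHS]ffunE /= cat_lshift.
rewrite cat_rshift ffunE /= cat_rshift.
by rewrite !gtn_eqF //; lia.
Qed.

Lemma splice_catr u s i y : splice (catw u s) (p + i)%N y = catw u (splice s i y).
Proof.
apply/ffunP => j; rewrite -[j]splitK; case: (split j) => a /=.
  rewrite cat_lshift ffunE /= cat_lshift.
  by rewrite !ltn_eqF //; have := ltn_ord a; lia.
by rewrite cat_rshift [LHS]ffunE [RHS]ffunE /= cat_rshift -addnS !eqn_add2l.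
Qed.

Lemma Top_col i x s : (i.+1 < p)%N -> colx (Top (p + r)%N R i x) s = Top p R i (colx x s).
Proof.
move=> h; apply/ffunP => u; rewrite ffunE.
have h0 : (i < p)%N by lia.
have k0 : (i < p + r)%N by lia.
have k1 : (i.+1 < p + r)%N by lia.
rewrite (TopE R x _ k0 k1) (TopE R _ u h0 h); congr (fun_of_fin (R _) _).
  by apply/ffunP => y; rewrite !ffunE splice_catl.
have -> : Ordinal k0 = lshift r (Ordinal h0) by apply: val_inj.
have -> : Ordinal k1 = lshift r (Ordinal h) by apply: val_inj.
by rewrite !cat_lshift.
Qed.

Lemma Top_row i x u : (i.+1 < r)%N -> rowx (Top (p + r)%N R (p + i)%N x) u = Top r R i (rowx x u).
Proof.
move=> h; apply/ffunP => s; rewrite ffunE.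
have h0 : (i < r)%N by lia.
have k0 : (p + i < p + r)%N by lia.
have k1 : ((p + i)%N.+1 < p + r)%N by lia.
rewrite (TopE R x _ k0 k1) (TopE R _ s h0 h); congr (fun_of_fin (R _) _).
  by apply/ffunP => y; rewrite !ffunE splice_catr.
have -> : Ordinal k0 = rshift p (Ordinal h0) by apply: val_inj.
have -> : Ordinal k1 = rshift p (Ordinal h) by apply: val_inj; rewrite /= addnS.
by rewrite !cat_rshift.
Qed.

Lemma Sfam_col i x : (i.+1 < p)%N ->
  x \in Sfam q R (p + r)%N i <-> forall s, colx x s \in Sfam q R p i.
Proof.
move=> h; split=> [/memv_imgP [y _ ->] s|H].
  apply/memv_imgP; exists (colx y s); rewrite ?memvf // !(add_lfunE, opp_lfunE, scale_lfunE, id_lfunE).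
  by rewrite -Top_col //; apply/ffunP => u; rewrite !ffunE.
pose f := (Top p R i - q *: \1)%VF.
(* A linear one-sided inverse of [f], applied column by column, assembles a preimage of [x]. *)
pose y : Vm := [ffun w => (f^-1)%VF (colx x (rw w)) (lw w)].
apply/memv_imgP; exists y; rewrite ?memvf //.
apply/ffunP => w; rewrite -(cat_lr w); set u := lw w; set s := rw w.
have cy : colx y s = (f^-1)%VF (colx x s) by apply/ffunP => u'; rewrite !ffunE lw_cat rw_cat.
have := limg_lfunVK (H s); rewrite -/f -cy => E.
have := congr1 (fun z : Vp => z u) E.
rewrite /f !(add_lfunE, opp_lfunE, scale_lfunE, id_lfunE) -Top_col // !ffunE => <-.
by [].
Qed.

Lemma Sfam_row i x : (i.+1 < r)%N ->
  x \in Sfam q R (p + r)%N (p + i)%N <-> forall u, rowx x u \in Sfam q R r i.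
Proof.
move=> h; split=> [/memv_imgP [y _ ->] s|H].
  apply/memv_imgP; exists (rowx y s); rewrite ?memvf // !(add_lfunE, opp_lfunE, scale_lfunE, id_lfunE).
  by rewrite -Top_row //; apply/ffunP => u; rewrite !ffunE.
pose f := (Top r R i - q *: \1)%VF.
pose y : Vm := [ffun w => (f^-1)%VF (rowx x (lw w)) (rw w)].
apply/memv_imgP; exists y; rewrite ?memvf //.
apply/ffunP => w; rewrite -(cat_lr w); set u := lw w; set s := rw w.
have cy : rowx y u = (f^-1)%VF (rowx x u) by apply/ffunP => u'; rewrite !ffunE lw_cat rw_cat.
have := limg_lfunVK (H u); rewrite -/f -cy => E.
have := congr1 (fun z : Vr => z s) E.
rewrite /f !(add_lfunE, opp_lfunE, scale_lfunE, id_lfunE) -Top_row // !ffunE => <-.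
by [].
Qed.

Lemma Sfam_ideal_row x :
  x \in (\sum_(p <= j < (p + r)%N.-1) Sfam q R (p + r)%N j)%VS <->
  forall u, rowx x u \in ideal_deg (Sfam q R) r.
Proof.
rewrite /ideal_deg; split.
  move=> xS u; rewrite -(big_mkord predT (fun i => Sfam q R r i)).
  move: x xS; apply: sumv_nat_ind => [|x y Hx Hy|j pj x Wx].
  - have -> : rowx (0 : Vm) u = 0 :> Vr by apply/ffunP => s; rewrite !ffunE.
    exact: mem0v.
  - have -> : rowx (x + y) u = rowx x u + rowx y u by apply/ffunP => s; rewrite !ffunE.
    by rewrite memvD.
  have ej : j = (p + (j - p))%N by lia.
  apply: (@memv_sum_nat _ _ _ _ _ (j - p)); first by lia.
  have h' : ((j - p).+1 < r)%N by lia.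
  by apply: (proj1 (Sfam_row x h')); rewrite -ej.
move=> H.
(* Cut [x] by the left part of the word, then decompose each row inside the ideal and put the pieces
   back beside that left part. *)
have -> : x = \sum_u [ffun w => if lw w == u then x w else 0] :> Vm.
  apply/ffunP => w; rewrite sum_ffunE (bigD1 (lw w)) //= big1 => [|u /negbTE nu].
    by rewrite ffunE eqxx addr0.
  by rewrite ffunE eq_sym nu.
apply: memv_suml => u _.
have [ys yS eu] := memv_sumP (H u).
have -> : [ffun w => if lw w == u then x w else 0] =
    \sum_(i < r.-1) [ffun w => if lw w == u then ys i (rw w) else 0] :> Vm.
  apply/ffunP => w; rewrite sum_ffunE ffunE.
  under eq_bigr do rewrite ffunE.
  case: eqP => [e|_]; last by rewrite big1.
  have := congr1 (fun z : Vr => z (rw w)) eu; rewrite sum_ffunE ffunE -e cat_lr.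
  by move=> ->.
apply: memv_suml => i _; apply: (@memv_sum_nat _ _ _ _ _ (p + i)%N).
  by have := ltn_ord i; lia.
apply/Sfam_row; first by have := ltn_ord i; lia.
move=> u'; have [e|ne] := eqVneq u' u.
  have -> : rowx ([ffun w => if lw w == u then ys i (rw w) else 0] : Vm) u' = ys i.
    by apply/ffunP => s; rewrite !ffunE lw_cat rw_cat e eqxx.
  exact: yS.
have -> : rowx ([ffun w => if lw w == u then ys i (rw w) else 0] : Vm) u' = 0 :> Vr.
  by apply/ffunP => s; rewrite !ffunE lw_cat (negbTE ne).
exact: mem0v.
Qed.

Lemma Zc_col x : x \in Zc (Sfam q R) (p + r)%N p <-> forall s, colx x s \in Zc (Sfam q R) p p.
Proof.
rewrite /Zc; split=> [/memv_bigcap_ord H s|H].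
  apply/memv_bigcap_ord => i ip; have h : (i.+1 < p)%N by lia.
  exact: (proj1 (Sfam_col x h) (H i ip)).
apply/memv_bigcap_ord => i ip; apply/Sfam_col; first by lia.
by move=> s; have /memv_bigcap_ord := H s; apply.
Qed.

(** The term A^!_p (x) A_r, as the quotient of A^!_p (x) V_r by A^!_p (x) I_r. *)
Lemma dim_koszul_term :
  (\dim (Zc (Sfam q R) (p + r)%N p) - \dim (Bd (Sfam q R) (p + r)%N p) =
   \dim (Zc (Sfam q R) p p) * hilb (Sfam q R) r)%N.
Proof.
have -> : \dim (Zc (Sfam q R) (p + r)%N p) = (\dim (Zc (Sfam q R) p p) * \dim {:Vr})%N.
  apply: dim_cols_rows => x; split=> [/Zc_col H|[H _]]; last by apply/Zc_col.
  by split=> // u; rewrite memvf.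
have -> : \dim (Bd (Sfam q R) (p + r)%N p) =
    (\dim (Zc (Sfam q R) p p) * \dim (ideal_deg (Sfam q R) r))%N.
  apply: dim_cols_rows => x; rewrite /Bd memv_cap; split.
    by move=> /andP [/Zc_col H1 /Sfam_ideal_row H2].
  by move=> [H1 H2]; apply/andP; split; [apply/Zc_col|apply/Sfam_ideal_row].
by rewrite -mulnBr.
Qed.
End TopSplit.

(** * Euler characteristic of the Koszul complex *)

Section Euler.
Variables (F : fieldType) (d : nat) (W : qfam F d).

Lemma Zc_sub m p p' : (p' <= p)%N -> (Zc W m p <= Zc W m p')%VS.
Proof.
move=> le; apply/subvP => x /memv_bigcap_ord H; apply/memv_bigcap_ord => i ip.
by apply: H; lia.
Qed.

Lemma Bd_sub m p : (Bd W m p.+1 <= Bd W m p)%VS.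
Proof.
apply/subvP => x; rewrite /Bd !memv_cap => /andP [xZ xS].
rewrite (subvP (Zc_sub m (leqnSn p)) _ xZ) /=.
move: x xS {xZ}; apply: sumv_nat_ind => [|x y|j pj x]; first exact: mem0v.
- exact: memvD.
- by apply: memv_sum_nat; lia.
Qed.

(** Boundaries are cycles; together with [koszul] the inclusion becomes an equality. *)
Lemma Zc_sub_Kker m p : (p < m)%N -> (Zc W m p.+1 + Bd W m p <= Kker W m p)%VS.
Proof.
case: p => [|p] pm; first exact: subvf.
rewrite subv_add !subv_cap; apply/andP; split; apply/andP; split.
- exact: Zc_sub.
- rewrite (Zc_sub m (p := p.+2) (p' := p)) /=; last by lia.
  apply/subvP => x /memv_bigcap_ord H; apply: (@memv_sum_nat _ _ _ _ _ p); first by lia.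
  by apply: H.
- exact: capvSl.
- by have := Bd_sub m p; rewrite /Bd subv_cap.
Qed.

(** [Kker] in degree [p.+1] is the intersection of [Zc] there with [Bd] in degree [p], so the
    dimension formula for sums links consecutive degrees and the alternating sum telescopes. *)
Lemma koszul_euler m : koszul W -> (0 < m)%N ->
  \sum_(p < m.+1) (-1) ^+ p * ((\dim (Zc W m p))%:Z - (\dim (Bd W m p))%:Z) = 0.
Proof.
move=> kW m0.
have K0 : Kker W m m = 0%VS by case: m m0 => // m' _; rewrite /Kker /Bd big_geq // !capv0.
pose z p : int := (\dim (Zc W m p))%:Z; pose b p : int := (\dim (Bd W m p))%:Z.
pose ka p : int := (\dim (Kker W m p))%:Z.
have rec p : (p < m)%N -> ka p - b p = z p.+1 - ka p.+1.
  move=> pm; have := dimv_sum_cap (Zc W m p.+1) (Bd W m p).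
  have -> : (Zc W m p.+1 + Bd W m p)%VS = Kker W m p.
    by apply/eqP; rewrite eqEsubv Zc_sub_Kker //= kW // ltnW.
  by rewrite -[(_ :&: _)%VS]/(Kker W m p.+1) /ka /b /z; lia.
have b0 : b m = 0.
  by rewrite /b /Bd big_geq ?capv0 ?dimv0 // leq_pred.
have ka0 : ka m = 0 by rewrite /ka K0 dimv0.
have part j : (j <= m)%N ->
    \sum_(p < j) (-1) ^+ p * (z p - b p) = - ((-1) ^+ j * (z j - ka j)).
  elim: j => [|j IH] jm.
    by rewrite big_ord0 /z /ka /Zc /= big_ord0 subrr mulr0 oppr0.
  rewrite big_ord_recr /= IH; last by lia.
  have -> : z j - b j = (z j - ka j) + (z j.+1 - ka j.+1) by rewrite -rec //; ring.
  by rewrite exprS; ring.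
by rewrite big_ord_recr /= part // -/(z m) -/(b m) b0 ka0 subr0 addNr.
Qed.
End Euler.

(** The left side is the dimension of a component of the Koszul dual coalgebra of S(V,R);
    [source_dim] matches it with Lambda(V,R). *)
Lemma dim_Zc_hilb (F : fieldType) (d : nat) (q : F) (R : 'End(tens F d 2)) p :
  q != 0 -> onedim_source q R ->
  \dim (Zc (Sfam q R) p p) = hilb (Lfam q R) p.
Proof.
move=> q0 src; rewrite /hilb /ideal_deg /Zc; case: p => [|n'] /=.
  by rewrite !big_ord0 dimv0 subn0.
have := source_dim q0 src n'; rewrite big_mkord => <-.
by rewrite addnK.
Qed.

Lemma hilb_inverse_SL (F : fieldType) (d : nat) (q : F) (R : 'End(tens F d 2)) :
  q != 0 -> onedim_source q R -> hilb_inverse (Sfam q R) (Lfam q R).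
Proof.
move=> q0 src [|m].
  rewrite big_ord_recl big_ord0 addr0 expr0 mul1r /hilb /ideal_deg /= !big_ord0 dimv0 !subn0.
  by rewrite dimvf /dim /= card_ffun !card_ord expn0 !muln1.
have := koszul_euler (koszul_Xfam true q0 src : koszul (Sfam q R)) (ltn0Sn m).
(* The Euler characteristic carries its sign on the Lambda degree and the claim on the S degree: the
   sum is reversed and multiplied by a global sign. *)
rewrite (reindex_inj rev_ord_inj) /= => E.
have {}E : (-1) ^+ m.+1 * (\sum_(i < m.+2) (-1) ^+ i *
    ((hilb (Sfam q R) i)%:Z * (hilb (Lfam q R) (m.+1 - i))%:Z)) = 0 :> int.
  rewrite -[RHS]E mulr_sumr; apply: eq_bigr => i _.
  have im : (i <= m.+1)%N by rewrite -ltnS.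
  rewrite subSS; set p := (m.+1 - i)%N.
  have ep : m.+1 = (p + i)%N by rewrite /p subnK.
  have -> : (-1) ^+ m.+1 * ((-1) ^+ i * ((hilb (Sfam q R) i)%:Z * (hilb (Lfam q R) p)%:Z)) =
     (-1) ^+ p * ((hilb (Sfam q R) i)%:Z * (hilb (Lfam q R) p)%:Z) :> int.
    have -> : (-1) ^+ m.+1 = (-1) ^+ p * (-1) ^+ i :> int by rewrite -exprD -ep.
    have sq : (-1) ^+ i * (-1) ^+ i = 1 :> int.
      by rewrite -exprD addnn -mul2n exprM sqrrN !expr1n.
    by rewrite -mulrA [X in _ * X]mulrA sq mul1r.
  congr (_ * _).
  have le : (\dim (Bd (Sfam q R) (p + i) p) <= \dim (Zc (Sfam q R) (p + i) p))%N.
    by apply: dimvS; exact: capvSl.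
  have := dim_koszul_term p i q R; rewrite (dim_Zc_hilb p q0 src); rewrite -ep in le *.
  by move=> H; rewrite mulrC -PoszM -H; lia.
by move/eqP: E; rewrite mulf_eq0 expf_eq0 oppr_eq0 oner_eq0 andbF => /eqP.
Qed.

Theorem theorem3p1 (F : fieldType) (d : nat) (q : F) (R : 'End(tens F d 2)) :
  hecke_sym q R -> onedim_source q R ->
  [/\ koszul (Sfam q R), koszul (Lfam q R) & hilb_inverse (Sfam q R) (Lfam q R)].
Proof.
move=> [q0 _] src; split.
- exact: (koszul_Xfam true q0 src).
- exact: (koszul_Xfam false q0 src).
- exact: hilb_inverse_SL.
Qed.
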